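(* Let $G$ be $\mathrm{Isom}(\mathbb H^4)$, $\mathrm{Isom}(\mathbb A\mathrm d\mathbb S^4)$ or $G_{\mathsf{HP}^4}$, with Lie algebra $\mathfrak g$. The vector space $H^1_{\mathrm{Ad}\,\rho_0}(\Gamma_{22},\mathfrak g)$ has dimension $13$.
   Context: On $\mathbb R^5$ (coordinates $x_0,\dots,x_4$) let $q_{\pm1}(x)=-x_0^2+x_1^2+x_2^2+x_3^2\pm x_4^2$ and $q_0(x)=-x_0^2+x_1^2+x_2^2+x_3^2$. $\mathrm{Isom}(\mathbb H^4)$ is the subgroup of $\mathrm O(q_1)$ preserving $\{q_1=-1,x_0>0\}$; $\mathrm{Isom}(\mathbb A\mathrm d\mathbb S^4)=\mathrm O(q_{-1})$; $G_{\mathsf{HP}^4}$ is the group of linear maps $A$ preserving $q_0$ and $\{q_0=-1,x_0>0\}$ with $Ae_4=\pm e_4$ (it is isomorphic to $\mathrm O(1,3)\ltimes\mathbb R^4$). $\Gamma_{22}$ is the right-angled Coxeter group with $22$ generators $p_\varepsilon,m_\varepsilon$ ($\varepsilon=(\varepsilon_1,\varepsilon_2,\varepsilon_3)\in\{\pm1\}^3$), $\ell_{k,s}$ ($k\in\{1,2,3\}$, $s\in\{\pm1\}$), each of order two, with commutation relations: $p_\varepsilon$ and $m_\delta$ commute whenever $\varepsilon,\delta$ differ in at most one coordinate; $p_\varepsilon$ and $m_\varepsilon$ commute with $\ell_{k,s}$ whenever $\varepsilon_k=s$. $\rho_0:\Gamma_{22}\to G$ is the representation (the same block-diagonal matrices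 in all three cases) with $\rho_0(p_\varepsilon)=\mathrm{diag}(1,1,1,1,-1)$, $\rho_0(m_\varepsilon)=\mathrm{diag}(r_{v_\varepsilon},1)$ with $v_\varepsilon=(\sqrt2,\varepsilon_1,\varepsilon_2,\varepsilon_3)$, $\rho_0(\ell_{k,s})=\mathrm{diag}(r_{v_{k,s}},1)$ with $v_{k,s}=e_0+s\sqrt2e_k$, where for a unit spacelike vector $v$ of $\mathbb R^{1,3}$ (form $-x_0^2+x_1^2+x_2^2+x_3^2$), $r_v\in \mathrm O(1,3)$ is $-1$ on $v$ and the identity on $v^\perp$. $H^1_{\mathrm{Ad}\,\rho}(\Gamma,\mathfrak g)=Z^1/B^1$ is the usual first group cohomology with $\Gamma$ acting on $\mathfrak g$ by $\mathrm{Ad}\circ\rho$: cocycles satisfy $\tau(\gamma\eta)=\mathrm{Ad}\rho(\gamma)\tau(\eta)+\tau(\gamma)$; coboundaries are $\gamma\mapsto\mathrm{Ad}\rho(\gamma)v-v$. *)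

(* Defs.v *)
From HB Require Import structures.
From mathcomp Require Import all_boot all_order all_algebra generic_quotient.
From mathcomp Require Import all_classical all_reals all_analysis.

Set Implicit Arguments.
Unset Strict Implicit.
Unset Printing Implicit Defensive.

Import Order.TTheory GRing.Theory Num.Theory.
Import numFieldNormedType.Exports.

Local Open Scope classical_set_scope.
Local Open Scope ring_scope.
Local Open Scope quotient_scope.

(* The presentation < S | s^2 = 1, (st)^2 = 1 whenever comm s t >. As the
   generators are involutions, every element is a product of generators (no
   inverse letters are needed), and the relations say that commuting pairs of
   generators may be swapped. [racg_eqv] is the congruence on words spanned by
   the relations. *)
Inductive racg_eqv (S : Type) (comm : rel S) : seq S -> seq S -> Prop :=
| RacgRefl w : racg_eqv comm w w
| RacgSym w1 w2 : racg_eqv comm w1 w2 -> racg_eqv comm w2 w1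
| RacgTrans w1 w2 w3 :
    racg_eqv comm w1 w2 -> racg_eqv comm w2 w3 -> racg_eqv comm w1 w3
| RacgCat u1 u2 w1 w2 :
    racg_eqv comm u1 u2 -> racg_eqv comm w1 w2 ->
    racg_eqv comm (u1 ++ w1) (u2 ++ w2)
| RacgInvol s : racg_eqv comm [:: s; s] [::]
| RacgComm s t : comm s t -> racg_eqv comm [:: s; t] [:: t; s].

Section RightAngledCoxeterGroup.
Variables (S : choiceType) (comm : rel S).

Definition racg_eqvb : rel (seq S) := fun u w => `[< racg_eqv comm u w >].

Fact racg_eqvb_refl : reflexive racg_eqvb.
Proof. by move=> w; apply/asboolP; exact: RacgRefl. Qed.

Fact racg_eqvb_sym : symmetric racg_eqvb.
Proof. by move=> u w; apply/asboolP/asboolP; exact: RacgSym. Qed.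

Fact racg_eqvb_trans : transitive racg_eqvb.
Proof.
by move=> w u v /asboolP uw /asboolP wv; apply/asboolP; exact: RacgTrans uw wv.
Qed.

Canonical racg_equiv :=
  EquivRel racg_eqvb racg_eqvb_refl racg_eqvb_sym racg_eqvb_trans.

Definition racg : Type := {eq_quot racg_equiv}.
HB.instance Definition _ := Choice.on racg.
HB.instance Definition _ := EqQuotient.on racg.

Definition racg_word (w : seq S) : racg := \pi_racg w.

Lemma racg_wordP u w : racg_word u = racg_word w <-> racg_eqv comm u w.
Proof.
split; first by move=> /eqquotP /asboolP.
by move=> uw; apply/eqquotP/asboolP.
Qed.

Lemma racg_wordK (g : racg) : racg_word (repr g) = g.
Proof. exact: reprK. Qed.

Definition racg_gen (s : S) : racg := racg_word [:: s].
Definition racg_one : racg := racg_word [::].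
Definition racg_mul (g h : racg) : racg := racg_word (repr g ++ repr h).
Definition racg_inv (g : racg) : racg := racg_word (rev (repr g)).

Lemma racg_mul_word u w :
  racg_mul (racg_word u) (racg_word w) = racg_word (u ++ w).
Proof. by apply/racg_wordP; apply: RacgCat; apply/racg_wordP; rewrite racg_wordK. Qed.

Lemma racg_eqv_rev w1 w2 : racg_eqv comm w1 w2 -> racg_eqv comm (rev w1) (rev w2).
Proof.
elim=> {w1 w2}.
- by move=> w; exact: RacgRefl.
- by move=> w1 w2 _; exact: RacgSym.
- by move=> w1 w2 w3 _ h1 _ h2; exact: RacgTrans h1 h2.
- by move=> u1 u2 w1 w2 _ hu _ hw; rewrite !rev_cat; exact: RacgCat.
- by move=> s; exact: RacgInvol.
- by move=> s t st; apply: RacgSym; exact: RacgComm.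
Qed.

Lemma racg_inv_word w : racg_inv (racg_word w) = racg_word (rev w).
Proof.
by apply/racg_wordP; apply: racg_eqv_rev; apply/racg_wordP; rewrite racg_wordK.
Qed.

Lemma racg_eqv_catrev w : racg_eqv comm (w ++ rev w) [::].
Proof.
elim: w => [|s w IHw]; first exact: RacgRefl.
rewrite rev_cons -cats1 catA -(cat1s s w) -(catA [:: s]) -catA.
apply: (@RacgTrans _ _ _ ([:: s] ++ [::] ++ [:: s])); last exact: RacgInvol.
apply: RacgCat; first exact: RacgRefl.
by apply: RacgCat => //; exact: RacgRefl.
Qed.

Fact racg_mulA : associative racg_mul.
Proof.
move=> f g h; rewrite -(racg_wordK f) -(racg_wordK g) -(racg_wordK h).
by rewrite !racg_mul_word catA.
Qed.

Fact racg_mul1 : left_id racg_one racg_mul.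
Proof. by move=> g; rewrite -(racg_wordK g) racg_mul_word. Qed.

Fact racg_mulr1 : right_id racg_one racg_mul.
Proof. by move=> g; rewrite -(racg_wordK g) racg_mul_word cats0. Qed.

Fact racg_mulrV : right_inverse racg_one racg_inv racg_mul.
Proof.
move=> g; rewrite -(racg_wordK g) racg_inv_word racg_mul_word.
by apply/racg_wordP; exact: racg_eqv_catrev.
Qed.

Fact racg_mulV : left_inverse racg_one racg_inv racg_mul.
Proof.
move=> g; rewrite -(racg_wordK g) racg_inv_word racg_mul_word.
by apply/racg_wordP; rewrite -{2}(revK (repr g)); exact: racg_eqv_catrev.
Qed.

HB.instance Definition _ :=
  isGroup.Build racg racg_mulA racg_mul1 racg_mulr1 racg_mulV racg_mulrV.

Section Extension.
Variables (A : pzRingType) (f : S -> A).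

(* The extension to the group of a map on the generators; it is the
   homomorphism extending f as soon as f respects the relations
   ([racg_extM] and [racg_ext_gen]). *)
Definition racg_ext (g : racg) : A := \prod_(s <- repr g) f s.

Hypothesis f_invol : forall s, f s * f s = 1.
Hypothesis f_comm : forall s t, comm s t -> f s * f t = f t * f s.

Lemma racg_ext_word w : racg_ext (racg_word w) = \prod_(s <- w) f s.
Proof.
have : racg_eqv comm (repr (racg_word w)) w.
  by apply/racg_wordP; rewrite racg_wordK.
rewrite /racg_ext; move: (repr _) => u; elim=> // {u w}.
- by move=> w1 w2 w3 _ -> _ ->.
- by move=> u1 u2 w1 w2 _ hu _ hw; rewrite !big_cat /= hu hw.
- by move=> s; rewrite !big_cons !big_nil mulr1 f_invol.
- by move=> s t st; rewrite !big_cons !big_nil !mulr1 f_comm.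
Qed.

Lemma racg_ext_gen s : racg_ext (racg_gen s) = f s.
Proof. by rewrite racg_ext_word big_seq1. Qed.

Lemma racg_ext1 : racg_ext 1%g = 1.
Proof. by rewrite racg_ext_word big_nil. Qed.

Lemma racg_extM : {morph racg_ext : g h / (g * h)%g >-> g * h}.
Proof.
move=> g h; rewrite -(racg_wordK g) -(racg_wordK h).
rewrite [(_ * _)%g]racg_mul_word !racg_ext_word.
by rewrite big_cat.
Qed.

End Extension.

End RightAngledCoxeterGroup.

(* The sign +1 (resp. -1) is encoded by false (resp. true), as for the sign
   (-1) ^+ b; the index k = 1, 2, 3 is encoded by 0, 1, 2 : 'I_3. *)
Inductive gen22 : Type :=
| GenP of {ffun 'I_3 -> bool}
| GenM of {ffun 'I_3 -> bool}
| GenL of 'I_3 & bool.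

Definition gen22_code (s : gen22) :
    {ffun 'I_3 -> bool} + {ffun 'I_3 -> bool} + 'I_3 * bool :=
  match s with
  | GenP e => inl (inl e)
  | GenM e => inl (inr e)
  | GenL k s => inr (k, s)
  end.

Definition gen22_decode
    (c : {ffun 'I_3 -> bool} + {ffun 'I_3 -> bool} + 'I_3 * bool) : gen22 :=
  match c with
  | inl (inl e) => GenP e
  | inl (inr e) => GenM e
  | inr (k, s) => GenL k s
  end.

Fact gen22_codeK : cancel gen22_code gen22_decode.
Proof. by case. Qed.

HB.instance Definition _ := Finite.copy gen22 (can_type gen22_codeK).

(* [racg_eqv] symmetrizes this relation. *)
Definition comm22 (s t : gen22) : bool :=
  match s, t with
  | GenP e, GenM d => (#|[pred k | e k != d k]| <= 1)%N
  | GenP e, GenL k b => e k == b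
  | GenM e, GenL k b => e k == b
  | _, _ => false
  end.

Definition Gamma22 : groupType := racg comm22.

Section Representation.
Variable R : realType.

Definition minkJ : 'M[R]_(1 + 3) := block_mx (-1)%:M 0 0 1%:M.

Definition minkdot (u v : 'cV[R]_(1 + 3)) : R := (u^T *m minkJ *m v) 0 0.

(* The reflection x |-> x - 2 <x, v> v, for <v, v> = 1; see [reflmx_id] and
   [reflmx_perp]. *)
Definition reflmx (v : 'cV[R]_(1 + 3)) : 'M[R]_(1 + 3) :=
  1%:M - 2 *: (v *m v^T *m minkJ).

Definition vecM (e : {ffun 'I_3 -> bool}) : 'cV[R]_(1 + 3) :=
  col_mx (Num.sqrt 2)%:M (\col_k (-1) ^+ e k).

Definition vecL (k : 'I_3) (b : bool) : 'cV[R]_(1 + 3) :=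
  col_mx 1%:M (((-1) ^+ b * Num.sqrt 2) *: delta_mx k 0).

Definition diag41 (A : 'M[R]_(1 + 3)) (a : R) : 'M[R]_5 :=
  block_mx A 0 0 (a%:M : 'M[R]_1).

Definition rho0_gen (s : gen22) : 'M[R]_5 :=
  match s with
  | GenP e => diag41 1%:M (-1)
  | GenM e => diag41 (reflmx (vecM e)) 1
  | GenL k b => diag41 (reflmx (vecL k b)) 1
  end.

Definition rho0 : Gamma22 -> 'M[R]_5 := racg_ext rho0_gen.

Lemma minkdot_mx u v : u^T *m minkJ *m v = (minkdot u v)%:M.
Proof. exact: mx11_scalar. Qed.

Lemma minkJ_tr : minkJ^T = minkJ.
Proof. by rewrite /minkJ tr_block_mx !tr_scalar_mx !trmx0. Qed.

Lemma minkdotC u v : minkdot u v = minkdot v u.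
Proof.
by rewrite /minkdot -[in LHS](trmxK (_ *m _)) mxE !trmx_mul trmxK minkJ_tr mulmxA.
Qed.

Lemma reflmxE u v : reflmx v *m u = u - (2 * minkdot v u) *: v.
Proof.
rewrite /reflmx mulmxBl mul1mx -scalemxAl -!mulmxA (mulmxA v^T) minkdot_mx.
by rewrite mul_mx_scalar scalerA.
Qed.

Lemma reflmx_id v : minkdot v v = 1 -> reflmx v *m v = - v.
Proof.
by move=> vv; rewrite reflmxE vv mulr1 scaler_nat mulr2n opprD addrA subrr add0r.
Qed.

Lemma reflmx_perp u v : minkdot v u = 0 -> reflmx v *m u = u.
Proof. by move=> vu; rewrite reflmxE vu mulr0 scale0r subr0. Qed.

Lemma reflmx_mul u v : reflmx u *m reflmx v =
  reflmx v - 2 *: (u *m (u^T *m minkJ *m reflmx v)).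
Proof.
by rewrite {1}/reflmx mulmxBl mul1mx -scalemxAl !mulmxA.
Qed.

Lemma reflmx_dual u v : u^T *m minkJ *m reflmx v =
  u^T *m minkJ - (2 * minkdot u v) *: (v^T *m minkJ).
Proof.
rewrite /reflmx mulmxBr mulmx1 -scalemxAr !mulmxA minkdot_mx mul_scalar_mx.
by rewrite -scalemxAl scalerA.
Qed.

Lemma reflmx_invol v : minkdot v v = 1 -> reflmx v *m reflmx v = 1%:M.
Proof.
move=> vv; rewrite reflmx_mul reflmx_dual vv mulr1 mulmxBr -scalemxAr !mulmxA.
rewrite /reflmx; set W := v *m v^T *m minkJ.
have -> : W - 2 *: W = - W.
  by rewrite scaler_nat mulr2n opprD addrA subrr sub0r.
by rewrite scalerN opprK subrK.
Qed.

Lemma reflmx_comm u v : minkdot u v = 0 ->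
  reflmx u *m reflmx v = reflmx v *m reflmx u.
Proof.
move=> uv; rewrite !reflmx_mul !reflmx_dual uv minkdotC uv mulr0 !scale0r !subr0.
by rewrite /reflmx !mulmxA addrAC.
Qed.

Lemma minkdot_col (a b : R) (u v : 'cV[R]_3) :
  minkdot (col_mx a%:M u) (col_mx b%:M v) = - (a * b) + \sum_k u k 0 * v k 0.
Proof.
rewrite /minkdot /minkJ tr_col_mx mul_row_block mul_row_col.
rewrite !mulmx0 addr0 add0r mulmx1 tr_scalar_mx -!scalar_mxM mulrN1 mulNr.
rewrite mxE mxE eqxx mulr1n; congr (_ + _).
by rewrite mxE; apply: eq_bigr => k _; rewrite mxE.
Qed.

Lemma sqrt2M : Num.sqrt 2 * Num.sqrt 2 = 2 :> R.
Proof. by rewrite -expr2 sqr_sqrtr. Qed.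

Lemma minkdot_vecM e : minkdot (vecM e) (vecM e) = 1.
Proof.
rewrite minkdot_col sqrt2M (eq_bigr (fun=> 1)); last first.
  by move=> k _; rewrite mxE -expr2 sqrr_sign.
by rewrite sumr_const card_ord; apply: (addrI 2); rewrite addNKr natr1.
Qed.

Lemma minkdot_vecL k b : minkdot (vecL k b) (vecL k b) = 1.
Proof.
rewrite minkdot_col mulr1 (bigD1 k) //= big1; last first.
  by move=> j jk; rewrite !mxE (negPf jk) mulr0 mul0r.
rewrite !mxE !eqxx !mulr1 addr0 mulrACA -expr2 sqrr_sign mul1r sqrt2M.
by apply: (addrI 1); rewrite addNKr mulr2n.
Qed.

Lemma minkdot_vecML e k : minkdot (vecM e) (vecL k (e k)) = 0.
Proof.
rewrite minkdot_col mulr1 (bigD1 k) //= big1; last first.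
  by move=> j jk; rewrite !mxE (negPf jk) !mulr0.
by rewrite !mxE !eqxx mulr1 addr0 mulrA -expr2 sqrr_sign mul1r addNr.
Qed.

Lemma diag41M A B a b : diag41 A a * diag41 B b = diag41 (A *m B) (a * b).
Proof.
rewrite /diag41; apply: etrans; first exact: (@mulmx_block _ 4 1 4 1 4 1).
by rewrite !mulmx0 !mul0mx !addr0 !add0r -scalar_mxM.
Qed.

Lemma diag41_1 : diag41 1%:M 1 = 1.
Proof. by rewrite /diag41 -(@scalar_mx_block _ 4 1). Qed.

Lemma rho0_gen_invol s : rho0_gen s * rho0_gen s = 1.
Proof.
case: s => [e|e|k b]; rewrite /= diag41M -diag41_1; congr diag41.
- by rewrite mulmx1.
- by rewrite mulrNN mulr1.
- by rewrite reflmx_invol // minkdot_vecM.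
- by rewrite mulr1.
- by rewrite reflmx_invol // minkdot_vecL.
- by rewrite mulr1.
Qed.

Lemma rho0_gen_comm s t :
  comm22 s t -> rho0_gen s * rho0_gen t = rho0_gen t * rho0_gen s.
Proof.
case: s t => [e|e|k b] [d|d|j c]; rewrite /comm22 => st; try discriminate st.
all: rewrite /rho0_gen !diag41M.
- by rewrite mulmx1 mul1mx mulr1 mul1r.
- by rewrite mulmx1 mul1mx mulr1 mul1r.
- by move/eqP: st => <-; rewrite reflmx_comm // minkdot_vecML.
Qed.

Lemma rho0_gens s : rho0 (racg_gen comm22 s) = rho0_gen s.
Proof. exact: racg_ext_gen rho0_gen_invol rho0_gen_comm s. Qed.

Lemma rho0_1 : rho0 1%g = 1.
Proof. exact: racg_ext1 rho0_gen_invol rho0_gen_comm. Qed.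

Lemma rho0_M : {morph rho0 : g h / (g * h)%g >-> g * h}.
Proof. exact: racg_extM rho0_gen_invol rho0_gen_comm. Qed.

End Representation.

Section Geometries.
Variable R : realType.

Definition qform (s : R) (x : 'cV[R]_5) : R :=
  - x 0 0 ^+ 2 + x 1 0 ^+ 2 + x 2 0 ^+ 2 + x 3 0 ^+ 2 + s * x 4 0 ^+ 2.

(* The linear automorphisms of R^5 preserving the form; the condition
   A \in unitmx matters only for the degenerate form s = 0. *)
Definition orthogonal_group (s : R) : set 'M[R]_5 :=
  [set A | A \in unitmx /\ forall x : 'cV[R]_5, qform s (A *m x) = qform s x].

Definition upper_sheet (s : R) : set 'cV[R]_5 :=
  [set x | qform s x = -1 /\ 0 < x 0 0].

Definition preserves (A : 'M[R]_5) (U : set 'cV[R]_5) : Prop :=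
  [set A *m x | x in U] = U.

Definition IsomH4 : set 'M[R]_5 :=
  [set A | orthogonal_group 1 A /\ preserves A (upper_sheet 1)].

Definition IsomAdS4 : set 'M[R]_5 := orthogonal_group (-1).

Definition G_HP4 : set 'M[R]_5 :=
  [set A | [/\ orthogonal_group 0 A, preserves A (upper_sheet 0) &
     let e4 : 'cV[R]_5 := delta_mx 4 0 in A *m e4 = e4 \/ A *m e4 = - e4]].

(* The Lie algebra of a matrix group, as its tangent space at the identity:
   the velocities at 0 of the differentiable curves in G through 1. *)
Definition lie_algebra (n : nat) (G : set 'M[R]_n.+1) : set 'M[R]_n.+1 :=
  [set X | exists c : R -> 'M[R]_n.+1,
     [/\ c 0 = 1, \forall t \near (0 : R), G (c t) /\ derivable c t 1 &
         is_derive (0 : R) 1 c X]].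

End Geometries.

Section Cohomology.
Variables (R : realType) (Gamma : groupType) (n : nat).
Variables (rho : Gamma -> 'M[R]_n.+1) (g : set 'M[R]_n.+1).

Definition Ad (A X : 'M[R]_n.+1) : 'M[R]_n.+1 := A *m X *m invmx A.

Definition cocycles : set (Gamma -> 'M[R]_n.+1) :=
  [set tau | (forall a, g (tau a)) /\
     forall a b, tau (a * b)%g = Ad (rho a) (tau b) + tau a].

Definition coboundaries : set (Gamma -> 'M[R]_n.+1) :=
  [set tau | exists2 v, g v & forall a, tau a = Ad (rho a) v - v].

End Cohomology.

(* dim (Z / B) = d for subspaces B `<=` Z of V: the classes modulo B of some
   d elements of Z form a basis of Z / B. *)
Definition quotient_dim (R : pzRingType) (V : lmodType R) (Z B : set V)
    (d : nat) : Prop :=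
  exists b : 'I_d -> V, (forall i, Z (b i)) /\
    forall z, Z z -> exists! c : 'rV[R]_d, B (z - \sum_i c 0 i *: b i).

(* dim H^1_{Ad rho}(Gamma, g) = d, where H^1 = Z^1 / B^1. *)
Definition H1_dim (R : realType) (Gamma : groupType) (n : nat)
    (rho : Gamma -> 'M[R]_n.+1) (g : set 'M[R]_n.+1) (d : nat) : Prop :=
  quotient_dim (cocycles rho g) (coboundaries rho g) d.

(* Main.v *)
(* All three Lie algebras consist of the block matrices [a, s w; - w^* , 0], with
   a in o(1,3), w in R^(1,3), w^* dual to w and s = 1, -1, 0: one inclusion is
   the derivative of the equations of the group, the other uses the Cayley
     curves
   (1 + t X / 2) (1 - t X / 2)^-1. The block diagonal matrices act by
   (a, w) |-> (B a B^-1, +- B w), whatever s, so the cohomology splits as the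
     sum
   of those of o(1,3) and of R^(1,3) twisted by a sign.

   A cocycle is given by its values on the generators. In o(1,3), it vanishes on
   the p_e and displaces each unit vector v of a reflection by some x in its
   orthogonal, with <x, v'> + <v, x'> = 0 whenever v, v' are orthogonal. The
   vectors of the three l_(k, e_k) form a basis of the orthogonal of v_e, so
     the 18
   coordinates of the displacements of the six l_(k, s) are free and determine
   the rest; dividing by the 6-dimensional space of coboundaries leaves 12. In
   R^(1,3), the value on m_e or l_(k, s) is the projection to its vector of the
   value on each commuting p_d, and modulo coboundaries there is only one
   cocycle, p_e, m_e |-> e_1 e_2 e_3 v_e. *)
Require Import Defs.
From mathcomp Require Import all_boot all_order all_algebra.
From mathcomp Require Import all_classical all_reals all_analysis.
From mathcomp Require Import ring lra.

Set Implicit Arguments.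
Unset Strict Implicit.
Unset Printing Implicit Defensive.

Import Order.TTheory GRing.Theory Num.Theory.
Import numFieldNormedType.Exports.

Local Open Scope classical_set_scope.
Local Open Scope ring_scope.

(** * Cocycles of a right-angled Coxeter group *)

Section Adjoint.
Variables (R : realType) (n : nat).
Implicit Types A B X Y : 'M[R]_n.+1.

Lemma AdD A X Y : Ad A (X + Y) = Ad A X + Ad A Y.
Proof. by rewrite /Ad mulmxDr mulmxDl. Qed.

Lemma AdZ A k X : Ad A (k *: X) = k *: Ad A X.
Proof. by rewrite /Ad -scalemxAr -scalemxAl. Qed.

Lemma AdB A X Y : Ad A (X - Y) = Ad A X - Ad A Y.
Proof. by rewrite -scaleN1r AdD AdZ scaleN1r. Qed.

Lemma Ad0 A : Ad A 0 = 0.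
Proof. by rewrite /Ad mulmx0 mul0mx. Qed.

Lemma Ad1 X : Ad 1 X = X.
Proof. by rewrite /Ad mul1mx -[invmx 1]/(1^-1) invr1 mulmx1. Qed.

Lemma AdM A B X : A \is a GRing.unit -> B \is a GRing.unit ->
  Ad (A * B) X = Ad A (Ad B X).
Proof.
by move=> uA uB; rewrite /Ad -[invmx _]/((A * B)^-1) invrM // !mulmxA.
Qed.

Lemma Ad_invol A X : A * A = 1 -> Ad A X = A *m X *m A.
Proof.
move=> AA; rewrite /Ad -[invmx A]/(A^-1); congr (_ *m _).
have uA : A \is a GRing.unit by apply/unitrP; exists A.
by apply: (mulrI uA); rewrite divrr.
Qed.

End Adjoint.

Section RacgCohomology.
Variables (R : realType) (n : nat) (S : choiceType) (comm : rel S).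
Variables (f : S -> 'M[R]_n.+1) (g : set 'M[R]_n.+1).
Hypothesis f_invol : forall s, f s * f s = 1.
Hypothesis f_comm : forall s t, comm s t -> f s * f t = f t * f s.
Hypothesis g0 : g 0.
Hypothesis gD : forall X Y, g X -> g Y -> g (X + Y).
Hypothesis gZ : forall k X, g X -> g (k *: X).
Hypothesis g_Ad : forall s X, g X -> g (Ad (f s) X).

Local Notation rho := (racg_ext (comm := comm) f).
Local Notation Gamma := (racg comm).

(** The two equations are the cocycle identity read on the relations [s s = 1] and [s t = t s], a
    cocycle being zero at the identity. *)
Definition gen_cocycles : set (S -> 'M[R]_n.+1) :=
  [set D | [/\ forall s, g (D s), forall s, Ad (f s) (D s) + D s = 0 &
    forall s t, comm s t -> Ad (f s) (D t) + D s = Ad (f t) (D s) + D t]].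

Definition gen_coboundaries : set (S -> 'M[R]_n.+1) :=
  [set D | exists2 v, g v & forall s, D s = Ad (f s) v - v].

Lemma racg_wordM u w :
  (racg_word comm u * racg_word comm w)%g = racg_word comm (u ++ w).
Proof. exact: racg_mul_word. Qed.

Lemma f_unit s : f s \is a GRing.unit.
Proof. by apply/unitrP; exists (f s); rewrite f_invol. Qed.

Lemma prod_unit w : \prod_(s <- w) f s \is a GRing.unit.
Proof. by apply: rpred_prod => s _; exact: f_unit. Qed.

(** Unrolls [tau (s w) = Ad (f s) (tau w) + tau s] along a word. *)
Definition word_cocycle (D : S -> 'M[R]_n.+1) (w : seq S) : 'M[R]_n.+1 :=
  foldr (fun s X => Ad (f s) X + D s) 0 w.

Lemma word_cocycle_cat D u w : word_cocycle D (u ++ w) =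
  Ad (\prod_(s <- u) f s) (word_cocycle D w) + word_cocycle D u.
Proof.
elim: u => [|s u IHu] /=; first by rewrite big_nil Ad1 addr0.
by rewrite IHu big_cons AdM ?f_unit ?prod_unit // AdD addrA.
Qed.

(** By [word_cocycle_cat] the value on a concatenation depends only on the values on the two factors
    and the image of the first in the group, so checking the two kinds of relations suffices. *)
Lemma word_cocycle_eqv D u w : gen_cocycles D -> racg_eqv comm u w ->
  word_cocycle D u = word_cocycle D w.
Proof.
move=> [_ D_invol D_comm].
elim=> // {u w}.
- by move=> w1 w2 w3 _ -> _ ->.
- move=> u1 u2 w1 w2 uu hu _ hw; rewrite !word_cocycle_cat hu hw.
  by rewrite -!(racg_ext_word f_invol f_comm) (iffRL (racg_wordP _ _ _) uu).
- by move=> s /=; rewrite Ad0 add0r D_invol.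
- by move=> s t st /=; rewrite !Ad0 !add0r D_comm.
Qed.

Definition cocycle_ext (D : S -> 'M[R]_n.+1) (a : Gamma) : 'M[R]_n.+1 :=
  word_cocycle D (repr a).

Lemma cocycle_ext_word D w : gen_cocycles D ->
  cocycle_ext D (racg_word comm w) = word_cocycle D w.
Proof.
move=> ZD; apply: (word_cocycle_eqv ZD); apply/racg_wordP.
by rewrite racg_wordK.
Qed.

Lemma cocycle_ext_gen D s : gen_cocycles D ->
  cocycle_ext D (racg_gen comm s) = D s.
Proof. by move=> ZD; rewrite cocycle_ext_word //= Ad0 add0r. Qed.

Lemma cocycle_ext_cocycle D : gen_cocycles D -> cocycles rho g (cocycle_ext D).
Proof.
move=> ZD; split=> [a|a b].
  rewrite /cocycle_ext; case: ZD => gDs _ _.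
  by elim: (repr a) => [|s w IHw] //=; apply: gD => //; exact: g_Ad.
rewrite -(racg_wordK a) -(racg_wordK b) racg_wordM.
by rewrite !cocycle_ext_word // word_cocycle_cat (racg_ext_word f_invol f_comm).
Qed.

Lemma cocycle1 tau : cocycles rho g tau -> tau 1%g = 0.
Proof.
move=> [_ tauM]; have := tauM 1%g 1%g.
rewrite (racg_ext1 f_invol f_comm) Ad1 mulg1 -[X in X = _]addr0.
by move/addrI.
Qed.

Lemma cocycle_eq tau sig : cocycles rho g tau -> cocycles rho g sig ->
  (forall s, tau (racg_gen comm s) = sig (racg_gen comm s)) -> tau = sig.
Proof.
move=> Zt Zs ts; apply/funext => a; rewrite -(racg_wordK a).
elim: (repr a) => [|s w IHw]; first by rewrite !cocycle1.
rewrite -cat1s -racg_wordM; case: Zt Zs => _ -> [_ ->].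
by rewrite IHw [tau _]ts.
Qed.

Lemma cocycle_restr tau : cocycles rho g tau ->
  gen_cocycles (tau \o racg_gen comm).
Proof.
move=> Zt; have [gt tM] := Zt.
have gen_M s t : tau (racg_gen comm s * racg_gen comm t)%g =
    Ad (f s) (tau (racg_gen comm t)) + tau (racg_gen comm s).
  by rewrite tM racg_ext_gen.
split=> [s|s|s t st] /=; first exact: gt.
  rewrite -gen_M -(cocycle1 Zt) racg_wordM; congr tau.
  by apply/racg_wordP; exact: RacgInvol.
rewrite -!gen_M !racg_wordM; congr tau.
by apply/racg_wordP; exact: RacgComm.
Qed.

Lemma coboundary_cocycle v : g v -> cocycles rho g (fun a => Ad (rho a) v - v).
Proof.
move=> gv; have gN X : g X -> g (- X) by rewrite -scaleN1r; exact: gZ.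
have ru w : rho (racg_word comm w) = \prod_(s <- w) f s.
  exact: racg_ext_word.
split=> [a|a b].
  apply: gD; last exact: gN.
  rewrite -(racg_wordK a) ru; elim: (repr a) => [|s w IHw].
    by rewrite big_nil Ad1.
  by rewrite big_cons AdM ?f_unit ?prod_unit //; exact: g_Ad.
rewrite (racg_extM f_invol f_comm) -(racg_wordK a) -(racg_wordK b) !ru.
by rewrite AdM ?prod_unit // AdB addrA subrK.
Qed.

Lemma cocycles_comb (I : finType) (c : I -> R) (b : I -> Gamma -> 'M[R]_n.+1)
  tau :
  cocycles rho g tau -> (forall i, cocycles rho g (b i)) ->
  cocycles rho g (tau - \sum_i c i *: b i).
Proof.
move=> Zt Zb.
have ZD k x y : cocycles rho g x -> cocycles rho g y ->
    cocycles rho g (x + k *: y).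
  move=> [gx xM] [gy yM]; split=> [a|a b'].
    by apply: gD => //; exact: gZ.
  rewrite -[(x + k *: y) _]/(x _ + k *: y _) xM yM AdD AdZ scalerDr.
  by rewrite addrACA.
rewrite -sumrN; elim/big_rec: _ => [|i x _ IHx]; first by rewrite addr0.
by rewrite addrCA addrC -scaleNr; exact: ZD.
Qed.

(** Restriction to the generators is a linear bijection from cocycles onto [gen_cocycles], with
    inverse [cocycle_ext], and it matches the coboundaries. *)
Lemma gen_H1_dim d : quotient_dim gen_cocycles gen_coboundaries d ->
  H1_dim rho g d.
Proof.
move=> [b [Zb bP]]; exists (cocycle_ext \o b); split=> [i|tau Zt].
  exact: cocycle_ext_cocycle.
have Zbe i : cocycles rho g ((cocycle_ext \o b) i) by exact:
  cocycle_ext_cocycle.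
have eqB (c : 'rV[R]_d) :
    coboundaries rho g (tau - \sum_i c 0 i *: (cocycle_ext \o b) i) <->
    gen_coboundaries (tau \o racg_gen comm - \sum_i c 0 i *: b i).
  have restrE s : (tau - \sum_i c 0 i *: (cocycle_ext \o b) i) (racg_gen comm s)
      = (tau \o racg_gen comm - \sum_i c 0 i *: b i) s.
    rewrite -[LHS]/(_ - (\sum_i _) _) -[RHS]/(_ - (\sum_i _) _) !fct_sumE.
    congr (_ - _); apply: eq_bigr => i _.
    by rewrite -[LHS]/(_ *: cocycle_ext _ _) cocycle_ext_gen.
  split=> -[v gv cob]; exists v => // s.
    by rewrite -restrE cob racg_ext_gen.
  move: s; apply/funeqP; apply: cocycle_eq.
  - by apply: (@cocycles_comb _ (fun i => c 0 i)).
  - exact: coboundary_cocycle.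
  - by move=> s; rewrite restrE cob racg_ext_gen.
have [c [Bc cU]] := bP _ (cocycle_restr Zt).
exists c; split; first exact/eqB.
by move=> c' /eqB; exact: cU.
Qed.

End RacgCohomology.

(** * Dimension of a quotient from a linear parametrization *)

Section QuotientDim.
Variables (R : pzRingType) (V : lmodType R) (I : finType).
Variables (Z B : set V) (T : (I -> R) -> V).

(** The hypotheses say that [T] induces a linear bijection from the functions on [I] to [Z / B]; the
    images of the indicator functions then give the basis. *)
Lemma quotient_dim_param :
  (forall k c c', T (fun i => k * c i + c' i) = k *: T c + T c') ->
  (forall v w, B v -> B w -> B (v - w)) ->
  (forall c, Z (T c)) ->
  (forall z, Z z -> exists c, B (z - T c)) ->
  (forall c, B (T c) -> c =1 fun=> 0) ->
  quotient_dim Z B #|I|.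
Proof.
move=> T_lin B_sub ZT Z_dec T_inj.
have T0 : T (fun=> 0) = 0.
  have := T_lin (-1) (fun=> 0) (fun=> 0); rewrite scaleN1r addNr => <-.
  by congr T; apply/funext => i; rewrite mulr0 addr0.
pose e (j : 'I_#|I|) : I -> R := fun i => (i == enum_val j)%:R.
have sumT (c : 'rV_#|I|) : \sum_j c 0 j *: T (e j) =
    T (fun i => c 0 (enum_rank i)).
  have -> : (fun i => c 0 (enum_rank i)) = (fun i => \sum_j c 0 j * e j i).
    apply/funext => i; rewrite (bigD1 (enum_rank i)) //= /e enum_rankK eqxx
      mulr1.
    rewrite big1 ?addr0 // => j ji; case: eqP => [ij|]; last by rewrite mulr0.
    by rewrite ij enum_valK eqxx in ji.
  elim: (index_enum _) => [|j s IHs].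
    by rewrite big_nil -T0; congr T; apply/funext => i; rewrite big_nil.
  rewrite big_cons IHs -T_lin; congr T; apply/funext => i.
  by rewrite big_cons.
exists (fun j => T (e j)); split=> [j|z Zz]; first exact: ZT.
have [c Bc] := Z_dec z Zz.
exists (\row_j c (enum_val j)); split.
  rewrite sumT; congr (B (_ - T _)): Bc.
  by apply/funext => i; rewrite mxE enum_rankK.
move=> c'; rewrite sumT => Bc'; apply/rowP => j; rewrite mxE.
(* Two coordinate vectors of the same [z] differ by one that [T] sends into [B], hence by zero. *)
have /T_inj/(_ (enum_val j)) : B (T (fun i => -1 * c i + c' 0 (enum_rank i))).
  rewrite T_lin scaleN1r; have := B_sub _ _ Bc Bc'.
  by rewrite opprB [X in B X]addrC subrKA [X in B X]addrC.
by rewrite enum_valK mulN1r => /eqP; rewrite addrC subr_eq0 => /eqP.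
Qed.

End QuotientDim.

(** * Cayley curves *)

Section Cayley.
Variables (R : realType) (n : nat) (X : 'M[R]_n.+1).
Implicit Types t : R.

Local Notation Y := (2^-1 *: X).

(** With the inverse of [1 - t Y] written as adjugate over determinant, the Cayley transform [c] has
    rational entries, differentiable wherever [d] is nonzero. The factor 1/2 in [Y] makes its
    velocity at 0 equal to [X]. *)
Let P (s : R) : 'M[{poly R}]_n.+1 := 1%:M + (s *: 'X) *: map_mx polyC Y.
Let N := P 1 *m \adj (P (-1)).
Let d := \det (P (-1)).
Let c t := (d.[t])^-1 *: map_mx (horner_eval t) N.

Let evP s t : map_mx (horner_eval t) (P s) = 1 + (s * t) *: Y.
Proof.
apply/matrixP => i j; rewrite !mxE /horner_eval !hornerE.
by rewrite -[(i == j)%:R in LHS]polyC_natr hornerC.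
Qed.

Let dE t : d.[t] = \det (1 - t *: Y).
Proof.
rewrite /d -[_.[t]]/(horner_eval t _) -det_map_mx evP.
by rewrite mulN1r scaleNr.
Qed.

Let NE t : map_mx (horner_eval t) N = (1 + t *: Y) *m \adj (1 - t *: Y).
Proof. by rewrite map_mxM map_mx_adj !evP mul1r mulN1r scaleNr. Qed.

Let d0 : d.[0] = 1.
Proof. by rewrite dE scale0r subr0 det1. Qed.

Let N0 : map_mx (horner_eval 0) N = 1.
Proof.
rewrite NE !scale0r addr0 subr0 mul1mx.
by have := mul_adj_mx (1%:M : 'M[R]_n.+1); rewrite mulmx1 det1.
Qed.

Let c0 : c 0 = 1.
Proof. by rewrite /c N0 d0 invr1 scale1r. Qed.

Let cE t i j : c t i j = (d.[t])^-1 * (N i j).[t].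
Proof. by rewrite !mxE. Qed.

Let horner_cvg (p : {poly R}) : p.[t] @[t --> (0 : R)] --> p.[0].
Proof. exact: continuous_horner. Qed.

Let der_c t : d.[t] != 0 -> derivable c t 1.
Proof.
move=> dt; apply/derivable_mxP => i j; under eq_fun do rewrite cE.
apply: (@derivableM _ _ (fun t => (d.[t])^-1) (horner (N i j))).
  by apply: derivableV => //; exact: derivable_horner.
exact: derivable_horner.
Qed.

(* Reading the coefficient of degree one in
   [N * (1 - 'X * Y) = d * (1 + 'X * Y)]. *)
Let derN0 i j : (N i j)^`().[0] = X i j + d^`().[0] * (i == j)%:R.
Proof.
have NE0 k l : (N k l).[0] = (k == l)%:R.
  by have := congr1 (fun M : 'M[R]_n.+1 => M k l) N0; rewrite [LHS]mxE [RHS]mxE.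
have NP : N *m P (-1) = d *: P 1 by rewrite -mulmxA mul_adj_mx mul_mx_scalar.
have := congr1 (fun M : 'M[{poly R}]_n.+1 => (M i j)^`().[0]) NP.
rewrite /P mulmxDr mulmx1 -scalemxAr /=.
have addE (A B : 'M[{poly R}]_n.+1) k l : (A + B) k l = A k l + B k l.
  by rewrite mxE.
have scaleE p (A : 'M[{poly R}]_n.+1) k l : (p *: A) k l = p * A k l.
  by rewrite mxE.
have YE k l : map_mx polyC Y k l = (2^-1 * X k l)%:P by rewrite !mxE.
rewrite !(addE, scaleE) YE [1%:M _ _]mxE.
set q := (N *m _) _ _; have q0 : q.[0] = 2^-1 * X i j.
  rewrite /q mxE horner_sum (bigD1 i) //= big1 => [|k ki]; last first.
    by rewrite hornerM NE0 eq_sym (negPf ki) mul0r.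
  by rewrite hornerM NE0 eqxx mul1r addr0 YE hornerC.
rewrite -polyC_natr !poly.derivE !hornerE q0 d0 => h.
rewrite /= in h; lra.
Qed.

Let det_unit t : d.[t] != 0 -> 1 - t *: Y \in unitmx.
Proof. by rewrite dE unitmxE unitfE. Qed.

Let cY t : d.[t] != 0 -> c t *m (1 - t *: Y) = 1 + t *: Y.
Proof.
move=> dt; rewrite /c NE -scalemxAl -mulmxA mul_adj_mx -dE mul_mx_scalar.
by rewrite scalerA mulVf // scale1r.
Qed.

Let c_unit t : d.[t] != 0 -> (\det N).[t] != 0 -> c t \in unitmx.
Proof.
move=> dt Nt; rewrite unitmxE unitfE /c detZ det_map_mx mulf_neq0 //.
by rewrite expf_neq0 // invr_neq0.
Qed.

(** Quotient rule at 0, where [d] and [N] are 1: the term in [d'] cancels the one of [derN0]. *)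
Let is_derive_c : is_derive (0 : R) 1 c X.
Proof.
have d00 : d.[0] != 0 by rewrite d0 oner_neq0.
apply: DeriveDef; first exact: der_c.
rewrite derive_mx; last exact: der_c.
apply/matrixP => i j; rewrite mxE; under eq_fun do rewrite cE.
rewrite (@deriveM _ _ (fun t => (d.[t])^-1) (horner (N i j))); last 2 first.
- by apply: derivableV => //; exact: derivable_horner.
- exact: derivable_horner.
rewrite (deriveV d00 (@derivable_horner _ d 0)).
rewrite !derive_val derN0 d0 invr1 scale1r expr1n invr1.
have := congr1 (fun M : 'M[R]_n.+1 => M i j) N0; rewrite [LHS]mxE [RHS]mxE.
rewrite /horner_eval => ->; rewrite scaleN1r scalerN [_ *: d^`().[0]]mulrC.
by rewrite addrK.
Qed.

Lemma cayley_curve : exists c : R -> 'M[R]_n.+1,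
  [/\ c 0 = 1, is_derive (0 : R) 1 c X & \forall t \near (0 : R),
   [/\ derivable c t 1, c t \in unitmx, 0 < c t 0 0,
       1 - t *: Y \in unitmx & c t *m (1 - t *: Y) = 1 + t *: Y]].
Proof.
exists c; split=> //.
have dn : \forall t \near (0 : R), d.[t] != 0.
  by apply: (cvgr_neq0 _ (@horner_cvg d)); rewrite d0 oner_neq0.
have Nn : \forall t \near (0 : R), (\det N).[t] != 0.
  apply: (cvgr_neq0 _ (@horner_cvg (\det N))).
  by rewrite -[_.[0]]/(horner_eval 0 _) -det_map_mx N0 det1 oner_neq0.
(* The entry [N 0 0 / d] has the sign of the polynomial [d * N 0 0], which is continuous. *)
have cn : \forall t \near (0 : R), 0 < (d * N 0 0).[t].
  apply: (cvgr_gt _ (@horner_cvg (d * N 0 0))).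
  have := congr1 (fun M : 'M[R]_n.+1 => M 0 0) N0; rewrite [LHS]mxE [RHS]mxE.
  by rewrite /horner_eval eqxx hornerM d0 => ->; rewrite mulr1 ltr01.
near=> t.
have dt : d.[t] != 0 by near: t.
have Nt : (\det N).[t] != 0 by near: t.
have ct : 0 < d.[t] * (N 0 0).[t] by rewrite -hornerM; near: t.
split; [exact: der_c|exact: c_unit| |exact: det_unit|exact: cY].
have d2 : 0 < d.[t] ^+ 2 by rewrite exprn_even_gt0.
rewrite cE -(pmulr_rgt0 _ d2).
by rewrite (_ : _ * _ = d.[t] * (N 0 0).[t]) //; field.
Unshelve. all: by end_near. Qed.

End Cayley.

(** * Reflections acting on o(1,3) *)

Section Minkowski.
Variable R : realType.
Implicit Types (a : 'M[R]_(1 + 3)) (u v x y w : 'cV[R]_(1 + 3)).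

Local Notation J := (@minkJ R).

(* Locked so that reassociating products does not see through it. *)
Definition mdual v : 'rV[R]_(1 + 3) := locked (v^T *m J).

Lemma mdualE v : mdual v = v^T *m J.
Proof. by rewrite /mdual -lock. Qed.

Lemma mdual_mul u v : mdual u *m v = (minkdot u v)%:M.
Proof. by rewrite mdualE minkdot_mx. Qed.

Lemma minkJJ : J *m J = 1%:M.
Proof.
rewrite /minkJ mulmx_block !mulmx0 !mul0mx !addr0 add0r mulmx1 -scalar_mxM.
by rewrite mulrNN mulr1 -scalar_mx_block.
Qed.

Lemma mdualD u v : mdual (u + v) = mdual u + mdual v.
Proof. by rewrite !mdualE linearD mulmxDl. Qed.

Lemma mdualZ k u : mdual (k *: u) = k *: mdual u.
Proof. by rewrite !mdualE linearZ /= -scalemxAl. Qed.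

Lemma mdual_inj : injective mdual.
Proof.
move=> u v /(congr1 (mulmx^~ J)); rewrite !mdualE -!mulmxA minkJJ !mulmx1.
exact: trmx_inj.
Qed.

Lemma minkdotDr u v w : minkdot u (v + w) = minkdot u v + minkdot u w.
Proof. by rewrite /minkdot mulmxDr mxE. Qed.

Lemma minkdotZr u k v : minkdot u (k *: v) = k * minkdot u v.
Proof. by rewrite /minkdot -scalemxAr mxE. Qed.

Lemma minkdotDl u v w : minkdot (u + v) w = minkdot u w + minkdot v w.
Proof. by rewrite minkdotC minkdotDr !(minkdotC w). Qed.

Lemma minkdotZl k u v : minkdot (k *: u) v = k * minkdot u v.
Proof. by rewrite minkdotC minkdotZr minkdotC. Qed.

Lemma minkdot0r u : minkdot u 0 = 0.
Proof. by rewrite -(scale0r 0) minkdotZr mul0r. Qed.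

Lemma minkdot0l u : minkdot 0 u = 0.
Proof. by rewrite minkdotC minkdot0r. Qed.

Lemma minkdotNr u v : minkdot u (- v) = - minkdot u v.
Proof. by rewrite -scaleN1r minkdotZr mulN1r. Qed.

Lemma minkdot_suml (I : finType) (P : pred I) (F : I -> 'cV[R]_(1 + 3)) v :
  minkdot (\sum_(i | P i) F i) v = \sum_(i | P i) minkdot (F i) v.
Proof.
by apply: (big_morph (fun u => minkdot u v)) => [u w|];
  [exact: minkdotDl|exact: minkdot0l].
Qed.

(** Membership in o(1,3). *)
Definition skew a : Prop := a^T *m J = - (J *m a).

Lemma skew0 : skew 0.
Proof. by rewrite /skew trmx0 mul0mx mulmx0 oppr0. Qed.

Lemma skewD a b : skew a -> skew b -> skew (a + b).
Proof. by rewrite /skew linearD mulmxDl mulmxDr opprD => -> ->. Qed.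

Lemma skewZ k a : skew a -> skew (k *: a).
Proof.
by rewrite /skew linearZ /= -scalemxAl => ->; rewrite -scalemxAr scalerN.
Qed.

Lemma skew_mdual a v : skew a -> mdual (a *m v) = - (mdual v *m a).
Proof.
by move=> ska; rewrite !mdualE trmx_mul -[LHS]mulmxA ska mulmxN mulmxA.
Qed.

Lemma skew_dot a u v : skew a -> minkdot (a *m u) v = - minkdot u (a *m v).
Proof.
move=> ska; have := congr1 (fun M => (M *m v) 0 0) (skew_mdual u ska).
by rewrite mulNmx -mulmxA !mdualE => h; rewrite [LHS]h mxE.
Qed.

Lemma skew_dotvv a v : skew a -> minkdot v (a *m v) = 0.
Proof.
move=> ska; have := skew_dot v v ska; rewrite minkdotC => /eqP.
by rewrite -subr_eq0 opprK -mulr2n mulrn_eq0 => /eqP.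
Qed.

(** The element of o(1,3) attached to the bivector of [x] and [v]. For a unit [v] and [x] orthogonal
    to it, it sends [v] to [x]. *)
Definition wedge x v : 'M[R]_(1 + 3) := x *m mdual v - v *m mdual x.

Lemma wedge_mul x v u :
  wedge x v *m u = minkdot v u *: x - minkdot x u *: v.
Proof. by rewrite mulmxBl -!mulmxA !mdual_mul !mul_mx_scalar. Qed.

Lemma wedgeDl x y v : wedge (x + y) v = wedge x v + wedge y v.
Proof. by rewrite /wedge mulmxDl mdualD mulmxDr opprD addrACA. Qed.

Lemma wedgeZl k x v : wedge (k *: x) v = k *: wedge x v.
Proof. by rewrite /wedge -scalemxAl mdualZ -scalemxAr scalerBr. Qed.

Lemma wedge0l v : wedge 0 v = 0.
Proof. by rewrite -(scale0r 0) wedgeZl scale0r. Qed.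

Lemma wedgeC x v : wedge x v = - wedge v x.
Proof. by rewrite /wedge opprB. Qed.

Lemma skew_wedge x v : skew (wedge x v).
Proof.
rewrite /skew /wedge !mdualE linearB /= !trmx_mul !trmxK minkJ_tr mulmxBl.
by rewrite mulmxBr opprB !mulmxA.
Qed.

Lemma reflmx_selfadj v : (reflmx v)^T *m J = J *m reflmx v.
Proof.
rewrite /reflmx linearB linearZ /= trmx1 !trmx_mul trmxK minkJ_tr mulmxBl
  mul1mx.
by rewrite mulmxBr mulmx1 -scalemxAl -scalemxAr !mulmxA.
Qed.

(** The term quadratic in [v] carries the factor [<v, a v>], zero by skewness. *)
Lemma reflmx_conj a v : skew a -> minkdot v v = 1 ->
  reflmx v *m a *m reflmx v = a - 2 *: wedge (a *m v) v.
Proof.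
move=> ska vv; have va := skew_dotvv v ska.
have -> : reflmx v = 1%:M - 2 *: (v *m mdual v) by rewrite !mdualE mulmxA.
rewrite mulmxBl mul1mx -scalemxAl mulmxBr mulmx1 -scalemxAr mulmxBl.
rewrite -scalemxAl !mulmxA -(mulmxA _ a) -(mulmxA v (mdual v)) mdual_mul va.
rewrite raddf0 mulmx0 mul0mx scaler0 subr0.
by rewrite /wedge (skew_mdual _ ska) mulmxN opprK mulmxA scalerDr opprD addrAC
  addrA.
Qed.

(** The value of a cocycle on a reflection is thus known from the displacement [a v] of its
    vector. *)
Lemma reflmx_conj_opp a v : skew a -> minkdot v v = 1 ->
  reflmx v *m a *m reflmx v + a = 0 -> a = wedge (a *m v) v.
Proof.
move=> ska vv /eqP; rewrite reflmx_conj // addrAC -mulr2n -scaler_nat -scalerBr.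
by rewrite scaler_eq0 pnatr_eq0 subr_eq0 => /eqP.
Qed.

(* The data of a cocycle on commuting reflections in orthogonal unit vectors
   [u], [v]: infinitesimally, the two vectors stay orthogonal. *)
Lemma reflmx_conj_comm u v x y :
  minkdot u u = 1 -> minkdot v v = 1 -> minkdot u v = 0 ->
  minkdot x u = 0 -> minkdot y v = 0 ->
  reflmx u *m wedge y v *m reflmx u + wedge x u =
    reflmx v *m wedge x u *m reflmx v + wedge y v <->
  minkdot x v + minkdot u y = 0.
Proof.
move=> uu vv uv xu yv.
have vu : minkdot v u = 0 by rewrite minkdotC.
rewrite !reflmx_conj //; try exact: skew_wedge.
rewrite !wedge_mul uv vu !scale0r !sub0r -!scaleNr !wedgeZl (wedgeC v u).
rewrite scalerN -scaleNr opprK !scalerA (minkdotC u y).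
rewrite addrAC [RHS]addrAC (addrC (wedge x u)).
split=> [/addrI/(congr1 (fun M => M *m v))|h].
  rewrite -!scalemxAl wedge_mul uv vv scale1r scale0r subr0.
  by move/(congr1 (minkdot u)); rewrite !minkdotZr uu => h; lra.
by congr (_ + _ *: _); lra.
Qed.

End Minkowski.

(** * The vectors of the representation *)

Section Cuboctahedron.
Variable R : realType.
Implicit Types (e d : {ffun 'I_3 -> bool}) (x y w : 'cV[R]_(1 + 3)).

Local Notation sqrt2 := (Num.sqrt 2 : R).
Local Notation vM := (@vecM R).
Local Notation vL := (@vecL R).

Lemma col_mx_scalar x : x = col_mx (usubmx x 0 0)%:M (dsubmx x).
Proof. by rewrite -mx11_scalar vsubmxK. Qed.

Lemma cV4_eq x y : usubmx x 0 0 = usubmx y 0 0 ->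
  (forall j, dsubmx x j 0 = dsubmx y j 0) -> x = y.
Proof.
by move=> u d; rewrite (col_mx_scalar x) (col_mx_scalar y) u; congr col_mx;
  apply/colP.
Qed.

Lemma vecM_u e : usubmx (vM e) 0 0 = sqrt2.
Proof. by rewrite col_mxKu mxE mulr1n. Qed.

Lemma vecM_d e j : dsubmx (vM e) j 0 = (-1) ^+ e j.
Proof. by rewrite col_mxKd mxE. Qed.

Lemma vecL_u k b : usubmx (vL k b) 0 0 = 1.
Proof. by rewrite col_mxKu mxE mulr1n. Qed.

Lemma vecL_d k b j : dsubmx (vL k b) j 0 = (-1) ^+ b * sqrt2 * (j == k)%:R.
Proof. by rewrite col_mxKd !mxE eqxx andbT. Qed.

Lemma minkdot_vecLr x k b : minkdot x (vL k b) =
  - usubmx x 0 0 + (-1) ^+ b * sqrt2 * dsubmx x k 0.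
Proof.
rewrite {1}(col_mx_scalar x) minkdot_col mulr1 (bigD1 k) //= big1; last first.
  by move=> j jk; rewrite [X in _ * X]mxE [X in _ * (_ * X)]mxE (negPf jk)
    !mulr0.
by rewrite [X in _ * X + _]mxE [X in _ * (_ * X) + _]mxE !eqxx mulr1 addr0
  mulrC.
Qed.

Lemma minkdot_vecMr x e : minkdot x (vM e) =
  - (usubmx x 0 0 * sqrt2) + \sum_k (-1) ^+ e k * dsubmx x k 0.
Proof.
rewrite {1}(col_mx_scalar x) minkdot_col; congr (_ + _).
by apply: eq_bigr => k _; rewrite [X in _ * X]mxE mulrC.
Qed.

Lemma sqrt2_gt0 : 0 < sqrt2. Proof. by rewrite sqrtr_gt0. Qed.

(** Orthogonality to the three [vL] gives [(-1)^(e_k) x_k = x_0 / sqrt 2]; the product with [vM e]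
    is then [x_0 / sqrt 2], so [x_0 = 0]. *)
Lemma vecLM_nondeg e x : minkdot x (vM e) = 0 ->
  (forall k, minkdot x (vL k (e k)) = 0) -> x = 0.
Proof.
rewrite minkdot_vecMr => xM xL.
have sx k : (-1) ^+ e k * dsubmx x k 0 * 2 = usubmx x 0 0 * sqrt2.
  have := xL k; rewrite minkdot_vecLr => /eqP;
    rewrite addrC subr_eq0 => /eqP <-.
  by rewrite -[in LHS](sqrt2M R); ring.
have x0 : usubmx x 0 0 = 0.
  have : (\sum_k (-1) ^+ e k * dsubmx x k 0) * 2 = usubmx x 0 0 * sqrt2 * 3.
    by rewrite mulr_suml (eq_bigr _ (fun k _ => sx k)) sumr_const card_ord
      mulr_natr.
  move=> h; have /eqP : usubmx x 0 0 * sqrt2 = 0 by lra.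
  by rewrite mulf_eq0 (gt_eqF sqrt2_gt0) orbF => /eqP.
rewrite (col_mx_scalar x) x0 raddf0 -[RHS](@vsubmxK _ 1 3) !linear0;
  congr col_mx.
apply/colP => k; rewrite [RHS]mxE; have := sx k; rewrite x0 mul0r => /eqP.
by rewrite mulf_eq0 pnatr_eq0 orbF mulf_eq0 signr_eq0 => /eqP.
Qed.

Lemma minkdot_vecLL e i j : minkdot (vL i (e i)) (vL j (e j)) =
  2 * (i == j)%:R - 1.
Proof.
rewrite minkdot_vecLr vecL_u vecL_d eq_sym.
have s2 := sqrt2M R; case: eqVneq => [->|_]; last by rewrite !mulr0 addrC.
by rewrite !mulrb; case: (e _) => /=; lra.
Qed.

Definition sgn3 e : R := \prod_k (-1) ^+ e k.

(** If [e] and [d] differ in [m] coordinates, the product is [1 - 2 m] and the ratio of signs is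
    [(-1)^m]; these agree for [m = 0, 1]. This is what makes [p_e, m_e |-> sgn3 e v_e] a cocycle. *)
Lemma sgn3_vecMM e d : (#|[pred k | e k != d k]| <= 1)%N ->
  minkdot (vM d) (vM e) * sgn3 e = sgn3 d.
Proof.
set P := [pred k | e k != d k] => P1.
have vv : minkdot (vM d) (vM e) = 1 - 2 * #|P|%:R.
  rewrite minkdot_col sqrt2M (eq_bigr (fun k => 1 - 2 * (P k)%:R)); last first.
    move=> k _; rewrite [X in X * _]mxE [X in _ * X]mxE /=.
    by case: (e k); case: (d k); rewrite /=; ring.
  rewrite big_split /= sumr_const card_ord sumrN -mulr_sumr.
  have -> : \sum_i (P i)%:R = #|P|%:R :> R.
    by rewrite -natr_sum -sum1_card [in RHS]big_mkcond; congr (_%:R).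

  by ring.
have ss : sgn3 e = (-1) ^+ #|P| * sgn3 d.
  rewrite -prodr_const big_mkcond -big_split /=; apply: eq_bigr => k _.
  by rewrite inE; case: (e k); case: (d k); rewrite /=; ring.
by rewrite vv ss; case: #|P| P1 => [|[|//]] _; ring.
Qed.

(** In the sum on the left, coordinate [k] cancels and the others double. This dependence yields one
    scalar equation per edge of the cube. *)
Lemma vecM_edge e d k : (forall i, i != k -> d i = e i) -> d k = ~~ e k ->
  vM e + vM d = sqrt2 *: \sum_(i | i != k) vL i (e i).
Proof.
move=> de dk; rewrite scaler_sumr.
have c3 : #|[pred i : 'I_3 | i != k]| = 2.
  by have := cardC1 k; rewrite card_ord.
apply: cV4_eq => [|j]; rewrite [in LHS]linearD /= mxE linear_sum summxE.
  rewrite (eq_bigr (fun=> sqrt2)) => [|i _]; last first.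
    by rewrite linearZ /= mxE vecL_u mulr1.
  by rewrite sumr_const c3 !vecM_u.
rewrite !vecM_d.
rewrite (eq_bigr (fun i => 2 * ((-1) ^+ e i * (j == i)%:R))) => [|i _];
  last first.
  by rewrite linearZ /= mxE vecL_d -[in RHS](sqrt2M R); ring.
case: (eqVneq j k) => [->|jk].
  rewrite dk big1 => [|i ik]; last by rewrite eq_sym (negPf ik) !mulr0.
  by case: (e k); rewrite /=; ring.
rewrite (bigD1 j) //= big1 => [|i /andP[_ ij]]; last first.
  by rewrite eq_sym (negPf ij) !mulr0.
by rewrite de // eqxx mulr1; ring.
Qed.

(** The three space coordinates are free coordinates on the orthogonal of [vL k b]. *)
Lemma vecL_coord x k b : minkdot x (vL k b) = 0 ->
  x = col_mx ((-1) ^+ b * sqrt2 * dsubmx x k 0)%:M (dsubmx x).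
Proof.
rewrite minkdot_vecLr => /eqP; rewrite addrC subr_eq0 => /eqP ->.
exact: col_mx_scalar.
Qed.

End Cuboctahedron.

(** * Block form of the Lie algebras and the action of the generators *)

Section Blocks.
Variable R : realType.
Variable sigma : R.
Implicit Types (a B : 'M[R]_(1 + 3)) (w : 'cV[R]_(1 + 3)).

(** Here [sigma] is the coefficient of [x_4 ^ 2] in the form. The lower row does not involve it, so
    [w] can be recovered even when [sigma = 0]. *)
Definition mk a w : 'M[R]_5 :=
  block_mx a (sigma *: w) (- mdual w) (0 : 'M[R]_1).

Lemma mk_inj a w a' w' : mk a w = mk a' w' -> a = a' /\ w = w'.
Proof.
by move=> /(@eq_block_mx _ 4 1 4 1)[-> _ /oppr_inj/mdual_inj -> _].
Qed.

Lemma mkD a w a' w' : mk a w + mk a' w' = mk (a + a') (w + w').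
Proof.
apply: etrans; first exact: (@add_block_mx _ 4 1 4 1).
by rewrite /mk scalerDr mdualD opprD addr0.
Qed.

Lemma mkZ k a w : k *: mk a w = mk (k *: a) (k *: w).
Proof.
apply: etrans; first exact: (@scale_block_mx _ 4 1 4 1).
by rewrite /mk mdualZ scaler0 scalerN !scalerA mulrC.
Qed.

Lemma mkB a w a' w' : mk a w - mk a' w' = mk (a - a') (w - w').
Proof. by rewrite -(scaleN1r (mk a' w')) mkZ mkD !scaleN1r. Qed.

Lemma mk0 : mk 0 0 = 0.
Proof. by have := mkB 0 0 0 0; rewrite !subrr. Qed.

(** Self-adjointness of [B] turns [mdual w *m B] into the dual of [B *m w]; the resulting action on
    pairs [(a, w)] does not depend on [sigma]. *)
Lemma mk_conj B beta a w : B^T *m minkJ R = minkJ R *m B ->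
  diag41 B beta *m mk a w *m diag41 B beta =
  mk (B *m a *m B) (beta *: (B *m w)).
Proof.
move=> BJ; rewrite /diag41 /mk.
apply: etrans.
  apply: (congr1 (fun M : 'M[R]_(4 + 1) => mulmx M _)).
  exact: (@mulmx_block _ 4 1 4 1 4 1).
apply: etrans; first exact: (@mulmx_block _ 4 1 4 1 4 1).
rewrite !mulmx0 !mul0mx !addr0 !add0r !mul0mx ?addr0 ?add0r.
have -> : B *m (sigma *: w) *m beta%:M = sigma *: (beta *: (B *m w)).
  by rewrite mul_mx_scalar -scalemxAr !scalerA mulrC.
have -> : beta%:M *m - mdual w *m B = - mdual (beta *: (B *m w)).
  rewrite mul_scalar_mx -scalemxAl mulNmx mdualZ scalerN; congr (- (_ *: _)).
  by rewrite !mdualE trmx_mul -!mulmxA BJ.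
by [].
Qed.

Definition g_block : set 'M[R]_5 :=
  [set X | exists a w, skew a /\ X = mk a w].

Lemma g_block0 : g_block 0.
Proof. by exists 0, 0; rewrite mk0; split=> //; exact: skew0. Qed.

Lemma g_blockD X Y : g_block X -> g_block Y -> g_block (X + Y).
Proof.
move=> [a [w [ska ->]]] [a' [w' [ska' ->]]]; exists (a + a'), (w + w').
by rewrite mkD; split=> //; exact: skewD.
Qed.

Lemma g_blockZ k X : g_block X -> g_block (k *: X).
Proof.
move=> [a [w [ska ->]]]; exists (k *: a), (k *: w).
by rewrite mkZ; split=> //; exact: skewZ.
Qed.

Definition rot (s : gen22) : 'M[R]_(1 + 3) :=
  match s with
  | GenP _ => 1%:M
  | GenM e => reflmx (vecM R e)
  | GenL k b => reflmx (vecL R k b)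
  end.

Definition sgn4 (s : gen22) : R := if s is GenP _ then -1 else 1.

Lemma rot_selfadj s : (rot s)^T *m minkJ R = minkJ R *m rot s.
Proof. by case: s => *; rewrite /= ?reflmx_selfadj // trmx1 mul1mx mulmx1. Qed.

Lemma Ad_rho0_gen s a w : Ad (rho0_gen R s) (mk a w) =
  mk (rot s *m a *m rot s) (sgn4 s *: (rot s *m w)).
Proof.
rewrite Ad_invol; last exact: rho0_gen_invol.
by rewrite -mk_conj; [case: s|exact: rot_selfadj].
Qed.

Lemma skew_rot s a : skew a -> skew (rot s *m a *m rot s).
Proof.
rewrite /skew => ska; rewrite !trmx_mul -!mulmxA rot_selfadj (mulmxA _ _ (rot
  s)) ska.
by rewrite mulNmx mulmxN !mulmxA rot_selfadj.
Qed.

Lemma g_block_Ad s X : g_block X -> g_block (Ad (rho0_gen R s) X).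
Proof.
move=> [a [w [ska ->]]]; rewrite Ad_rho0_gen; do 2!eexists; split; last by [].
exact: skew_rot.
Qed.

(** The action respects the two components and [mk] is injective, so the equations decouple into
    those on [a] and those on [w]. *)
Lemma gen_cocycles_mk (a : gen22 -> 'M[R]_(1 + 3)) (w : gen22 -> 'cV[R]_(1 +
  3)) :
  gen_cocycles comm22 (rho0_gen R) g_block (fun s => mk (a s) (w s)) <->
  [/\ forall s, skew (a s),
      forall s, rot s *m a s *m rot s + a s = 0,
      forall s, sgn4 s *: (rot s *m w s) + w s = 0,
      forall s t, comm22 s t ->
        rot s *m a t *m rot s + a s = rot t *m a s *m rot t + a t &
      forall s t, comm22 s t ->
        sgn4 s *: (rot s *m w t) + w s = sgn4 t *: (rot t *m w s) + w t].
Proof.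
split=> [[g_D D_invol D_comm]|[sk ai wi ac wc]]; split.
- by move=> s; have [a' [w' [sk' /mk_inj[-> _]]]] := g_D s.
- by move=> s; have := D_invol s; rewrite Ad_rho0_gen mkD -mk0 => /mk_inj[].
- by move=> s; have := D_invol s; rewrite Ad_rho0_gen mkD -mk0 => /mk_inj[].
- by move=> s t /D_comm; rewrite !Ad_rho0_gen !mkD => /mk_inj[].
- by move=> s t /D_comm; rewrite !Ad_rho0_gen !mkD => /mk_inj[].
- by move=> s; exists (a s), (w s).
- by move=> s; rewrite Ad_rho0_gen mkD ai wi mk0.
- by move=> s t st; rewrite !Ad_rho0_gen !mkD ac // wc.
Qed.

End Blocks.

(** * Rigidity *)

Section GeneratorCocycles.
Variables (R : realType) (sigma : R).

Local Notation sqrt2 := (Num.sqrt 2 : R).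
Local Notation vM := (@vecM R).
Local Notation vL := (@vecL R).
Local Notation Z := (gen_cocycles comm22 (rho0_gen R) (g_block sigma)).
Local Notation B := (gen_coboundaries (rho0_gen R) (g_block sigma)).

Lemma gen_cocyclesB D E : Z D -> Z E -> Z (D - E).
Proof.
move=> [gD Di Dc] [gE Ei Ec].
split=> [s|s|s t st]; rewrite ?fctE.
- by apply: g_blockD => //; rewrite -scaleN1r; exact: g_blockZ.
- by rewrite AdB addrACA -opprD Di Ei subrr.
- by rewrite !AdB addrACA -opprD Dc // Ec // opprD addrACA.
Qed.

Lemma gen_coboundary_cocycle X : g_block sigma X ->
  Z (fun s => Ad (rho0_gen R s) X - X).
Proof.
move=> gX.
have Zc := coboundary_cocycle (@rho0_gen_invol R) (@rho0_gen_comm R)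
  (@g_blockD R sigma) (@g_blockZ R sigma) (@g_block_Ad R sigma) gX.
have := cocycle_restr (@rho0_gen_invol R) (@rho0_gen_comm R) Zc.
congr Z; apply/funext => s /=; rewrite racg_ext_gen //.
  exact: rho0_gen_invol.
exact: rho0_gen_comm.
Qed.

Lemma ord3P (P : 'I_3 -> Prop) : P 0 -> P 1 -> P 2 -> forall i, P i.
Proof.
move=> P0 P1 P2 [[|[|[|//]]] i3].
- by rewrite (_ : Ordinal i3 = 0) //; exact: val_inj.
- by rewrite (_ : Ordinal i3 = 1) //; exact: val_inj.
- by rewrite (_ : Ordinal i3 = 2) //; exact: val_inj.
Qed.

Definition ffun3 (a b c : bool) : {ffun 'I_3 -> bool} :=
  [ffun i : 'I_3 => nth false [:: a; b; c] i].

Lemma ffun3E (e : {ffun 'I_3 -> bool}) : e = ffun3 (e 0) (e 1) (e 2).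
Proof. by apply/ffunP; apply: ord3P; rewrite ffunE. Qed.

Lemma ffun3_val a b c :
  (ffun3 a b c 0 = a) * (ffun3 a b c 1 = b) * (ffun3 a b c 2 = c).
Proof. by rewrite !ffunE. Qed.

Lemma sum3 (F : 'I_3 -> R) : \sum_i F i = F 0 + F 1 + F 2.
Proof.
by rewrite !big_ord_recl big_ord0 addr0 addrA; congr (_ + F _ + F _);
  exact: val_inj.
Qed.

Lemma prod3 (F : 'I_3 -> R) : \prod_i F i = F 0 * F 1 * F 2.
Proof.
rewrite !big_ord_recl big_ord0 mulr1 mulrA.
by congr (_ * F _ * F _); exact: val_inj.
Qed.

Lemma comm22_flip (e d : {ffun 'I_3 -> bool}) k :
  (forall i, i != k -> d i = e i) -> comm22 (GenP e) (GenM d).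
Proof.
move=> de; apply: (leq_trans _ (eq_leq (card1 k))).
apply: subset_leq_card; apply/fintype.subsetP => i.
by rewrite !inE; apply: contraR => /de ->.
Qed.

(** The commutation equation of some [p_e], with value [w'], and a reflection, with value [w]: it
    reads [2 w = w' - r_v w' = 2 <v, w'> v]. *)
Lemma refl_double v w w' : minkdot v v = 1 :> R ->
  (-1 : R) *: (1%:M *m w) + w' = 1 *: (reflmx v *m w') + w ->
  w = minkdot v w' *: v.
Proof.
move=> vv; rewrite mul1mx scale1r scaleN1r reflmxE.
move: (minkdot v w') => m h; apply/colP => i.
by have := congr1 (fun M : 'cV[R]_(1 + 3) => M i 0) h; rewrite !mxE; lra.
Qed.

(* Write [v_e], [l_k] for the vectors of [m_e], [l_(k, e_k)], which form a basis,
   and [e'] for [e] with its k-th sign flipped. As [v_e + v_e'] is [sqrt 2]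
     times
   the sum of the [l_i], [i != k], the coefficients [A] of the [w] on the [v_e]
   and [L / sqrt 2] on the [l_k] satisfy the linear relations [edge] below, one
   for each edge of the cube. *)
Lemma gen_cocycle_rigid (a : gen22 -> 'M[R]_(1 + 3))
    (w : gen22 -> 'cV[R]_(1 + 3)) :
  Z (fun s => mk sigma (a s) (w s)) ->
  (forall k b, a (GenL k b) = 0) ->
  w (GenP (ffun3 false false false)) = 0 -> w (GenL 0 true) = 0 ->
  forall s, a s = 0 /\ w s = 0.
Proof.
move=> /gen_cocycles_mk[ska ai wi ac wc] aL wP0 wL0.
have aP e : a (GenP e) = 0.
  have /eqP := ai (GenP e); rewrite /= mulmx1 mul1mx -mulr2n -scaler_nat.
  by rewrite scaler_eq0 pnatr_eq0 => /eqP.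
have aM e : a (GenM e) = 0.
  have vv := minkdot_vecM R e.
  have aE : a (GenM e) = wedge (a (GenM e) *m vM e) (vM e).
    exact: reflmx_conj_opp (ska _) vv (ai (GenM e)).
  (* The displacement [x] of [v_e] is orthogonal to [v_e] by skewness, and to each [l_k] by
     commutation with [a (GenL k (e k)) = 0]; these vectors span. *)
  rewrite aE; set x := _ *m _; have x0 : minkdot x (vM e) = 0.
    by rewrite minkdotC skew_dotvv.
  rewrite (vecLM_nondeg x0) ?wedge0l // => k.
  have := ac (GenM e) (GenL k (e k)) (eqxx _).
  rewrite /= aL aE -/x -(wedge0l (vL k (e k))).
  move/(iffLR (reflmx_conj_comm vv (minkdot_vecL R k (e k)) (minkdot_vecML R e
    k)
    x0 (minkdot0l _))).
  by rewrite minkdot0r addr0.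
have wM (e d : {ffun 'I_3 -> bool}) k : (forall i, i != k -> d i = e i) ->
    w (GenM d) = minkdot (vM d) (w (GenP e)) *: vM d.
  move=> de; apply: refl_double; first exact: minkdot_vecM.
  exact: wc (comm22_flip de).
have wL (e : {ffun 'I_3 -> bool}) k : w (GenL k (e k)) = minkdot (vL k (e k))
  (w (GenP e)) *: vL k (e k).
  apply: refl_double; first exact: minkdot_vecL.
  exact: (wc (GenP e) (GenL k (e k)) (eqxx _)).
pose A (e : {ffun 'I_3 -> bool}) := minkdot (vM e) (w (GenM e)).
pose L k b := sqrt2 * minkdot (vL k b) (w (GenL k b)).
have AE (e d : {ffun 'I_3 -> bool}) k : (forall i, i != k -> d i = e i) ->
    A d = minkdot (vM d) (w (GenP e)).
  by move=> de; rewrite /A (wM _ _ _ de) minkdotZr minkdot_vecM mulr1.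
have LE (e : {ffun 'I_3 -> bool}) k : L k (e k) = sqrt2 * minkdot (vL k (e k))
  (w (GenP e)).
  by rewrite /L wL minkdotZr minkdot_vecL mulr1.
have edge (e d : {ffun 'I_3 -> bool}) k : (forall i, i != k -> d i = e i) -> d
  k = ~~ e k ->
    A e + A d = \sum_(i | i != k) L i (e i).
  move=> de dk; rewrite (AE _ _ _ de) (AE e e k) // -minkdotDl.
  rewrite (vecM_edge R de dk) minkdotZl minkdot_suml mulr_sumr.
  by apply: eq_bigr => i _; rewrite LE.
have edge0 b c : A (ffun3 false b c) + A (ffun3 true b c) = L 1 b + L 2 c.
  rewrite (edge _ _ 0); last by rewrite !ffunE.
    by rewrite big_mkcond sum3 /= !ffun3_val add0r.
  by apply: ord3P; rewrite !ffunE.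
have edge1 b c : A (ffun3 b false c) + A (ffun3 b true c) = L 0 b + L 2 c.
  rewrite (edge _ _ 1); last by rewrite !ffunE.
    by rewrite big_mkcond sum3 /= !ffun3_val addr0.
  by apply: ord3P; rewrite !ffunE.
have edge2 b c : A (ffun3 b c false) + A (ffun3 b c true) = L 0 b + L 1 c.
  rewrite (edge _ _ 2); last by rewrite !ffunE.
    by rewrite big_mkcond sum3 /= !ffun3_val addr0.
  by apply: ord3P; rewrite !ffunE.
have LP0 k : L k false = 0.
  have := LE (ffun3 false false false) k; rewrite wP0 minkdot0r mulr0.
  by congr (L _ _ = _); move: k; apply: ord3P; rewrite ffunE.
have L00 := LP0 0; have L10 := LP0 1; have L20 := LP0 2.
(* The generator [p] at the vertex +++ has value 0 and commutes with [m_d] for [d] equal or adjacent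
   to that vertex. *)
have AP0 (d : {ffun 'I_3 -> bool}) k : (forall i, i != k -> d i = false) -> A d
  = 0.
  move=> dk; rewrite (AE (ffun3 false false false) d k) ?wP0 ?minkdot0r //.
  move=> i ik; rewrite dk //.
  by move: i {ik}; apply: ord3P; rewrite ffunE.
have A000 : A (ffun3 false false false) = 0.
  by apply: (AP0 _ 0); apply: ord3P; rewrite ffunE.
have A100 : A (ffun3 true false false) = 0.
  by apply: (AP0 _ 0); apply: ord3P; rewrite ffunE.
have A010 : A (ffun3 false true false) = 0.
  by apply: (AP0 _ 1); apply: ord3P; rewrite ffunE.
have A001 : A (ffun3 false false true) = 0.
  by apply: (AP0 _ 2); apply: ord3P; rewrite ffunE.
have L01 : L 0 true = 0 by rewrite /L wL0 minkdot0r mulr0.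
(* The nine edges not through +++ determine the unknowns left: [A] at the other four vertices and
   [L 1 true], [L 2 true]. *)
have E0 := edge0 true true; have E1 := edge0 true false.
have E2 := edge0 false true; have F0 := edge1 true true.
have F1 := edge1 true false; have F2 := edge1 false true.
have G0 := edge2 true true; have G1 := edge2 true false.
have G2 := edge2 false true.
have A0 e : A e = 0.
  rewrite (ffun3E e).
  by case: (e 0); case: (e 1); case: (e 2) => //; lra.
have L0 k b : L k b = 0.
  case: b; last exact: LP0.
  by move: k; apply: ord3P => //; lra.
have wMd d : w (GenM d) = 0.
  by rewrite (wM d d 0) // -(AE d d 0) // A0 scale0r.
have wPL (e : {ffun 'I_3 -> bool}) k : minkdot (vL k (e k)) (w (GenP e)) = 0.
  have /eqP := LE e k; rewrite L0 eq_sym mulf_eq0 gt_eqF ?sqrt2_gt0 //.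
  by move/eqP.
case=> [e|e|k b]; split=> //.
  apply: (@vecLM_nondeg _ e) => [|k]; rewrite minkdotC ?wPL //.
  by rewrite -(AE e e 0) // A0.
by have := wL [ffun=> b] k; rewrite wPL ffunE scale0r.
Qed.

End GeneratorCocycles.

(** * The thirteen parameters *)

Section Parametrization.
Variables (R : realType) (sigma : R).

Local Notation sqrt2 := (Num.sqrt 2 : R).
Local Notation vM := (@vecM R).
Local Notation vL := (@vecL R).
Local Notation Z := (gen_cocycles comm22 (rho0_gen R) (g_block sigma)).
Local Notation B := (gen_coboundaries (rho0_gen R) (g_block sigma)).
Local Notation I := (option ('I_3 * bool * bool)).
Implicit Types (c : I -> R) (e d : {ffun 'I_3 -> bool}) (a : 'M[R]_(1 + 3)).

(* The coordinate of index [j] of the vector of [l_(k, s)] is displaced by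
   [eta c k s j]. Up to a coboundary, the displacements with [k = j + 1] vanish;
   the other twelve are free, and together with the scale [c None] of the
   translation part they make up the 13 parameters. *)
Definition eta c (k : 'I_3) (b : bool) (j : 'I_3) : R :=
  if k == j + 1 then 0 else c (Some (j, k == j, b)).

(** The first coordinate is forced by orthogonality to [vL k b]. *)
Definition xL c (k : 'I_3) (b : bool) : 'cV[R]_(1 + 3) :=
  col_mx ((-1) ^+ b * sqrt2 * eta c k b k)%:M (\col_j eta c k b j).

(** The product with [l_k] that commutation with [l_k] imposes on the displacement of [v_e]. *)
Definition yM c e k : R := - minkdot (xL c k (e k)) (vM e).

(** Solves the linear system with right-hand side [yM]: the Gram matrix of the [l_k] is [2 I - E],
    with [E] all ones, and its inverse is [(I - E) / 2]. *)
Definition xM c e : 'cV[R]_(1 + 3) :=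
  \sum_k (2^-1 * (yM c e k - \sum_j yM c e j)) *: vL k (e k).

Definition param_a c (s : gen22) : 'M[R]_(1 + 3) :=
  match s with
  | GenP _ => 0
  | GenM e => wedge (xM c e) (vM e)
  | GenL k b => wedge (xL c k b) (vL k b)
  end.

Definition param_w c (s : gen22) : 'cV[R]_(1 + 3) :=
  match s with
  | GenP e | GenM e => (c None * sgn3 R e) *: vM e
  | GenL _ _ => 0
  end.

Definition param c (s : gen22) : 'M[R]_5 := mk sigma (param_a c s) (param_w c
  s).

Lemma xL_u c k b : usubmx (xL c k b) 0 0 = (-1) ^+ b * sqrt2 * eta c k b k.
Proof. by rewrite col_mxKu mxE mulr1n. Qed.

Lemma xL_d c k b j : dsubmx (xL c k b) j 0 = eta c k b j.
Proof. by rewrite col_mxKd mxE. Qed.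

Lemma xL_lin k c c' j b :
  xL (fun i => k * c i + c' i) j b = k *: xL c j b + xL c' j b.
Proof.
have eta_lin i : eta (fun i => k * c i + c' i) j b i = k * eta c j b i + eta c'
  j b i.
  by rewrite /eta; case: ifP => // _; rewrite mulr0 addr0.
by apply: cV4_eq => [|i]; rewrite linearD linearZ /= [RHS]mxE [X in _ = X +
  _]mxE
  ?xL_u ?xL_d eta_lin; ring.
Qed.

Lemma xM_lin k c c' e : xM (fun i => k * c i + c' i) e = k *: xM c e + xM c' e.
Proof.
have y_lin j : yM (fun i => k * c i + c' i) e j = k * yM c e j + yM c' e j.
  by rewrite /yM xL_lin minkdotDl minkdotZl; ring.
rewrite /xM scaler_sumr -big_split; apply: eq_bigr => j _ /=.
rewrite scalerA -scalerDl (eq_bigr _ (fun i _ => y_lin i)) big_split /=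
  -mulr_sumr.
by rewrite y_lin; congr (_ *: _); ring.
Qed.

Lemma param_lin k c c' : param (fun i => k * c i + c' i) = k *: param c + param
  c'.
Proof.
apply/funext => s; rewrite -[RHS]/(k *: param c s + param c' s) /param mkZ mkD;
  congr (mk _ _ _).
  by case: s => [e|e|j b] /=; rewrite ?xM_lin ?xL_lin ?wedgeDl ?wedgeZl //
    scaler0 addr0.
by case: s => [e|e|j b] /=; rewrite ?scaler0 ?addr0 // scalerA -scalerDl;
  congr (_ *: _); ring.
Qed.

Lemma minkdot_xL c k b : minkdot (xL c k b) (vL k b) = 0.
Proof. by rewrite minkdot_vecLr xL_u xL_d addNr. Qed.

Lemma minkdot_vecLM e k : minkdot (vL k (e k)) (vM e) = 0.
Proof. by rewrite minkdotC minkdot_vecML. Qed.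

Lemma minkdot_xM c e : minkdot (xM c e) (vM e) = 0.
Proof.
by rewrite minkdot_suml big1 // => k _; rewrite minkdotZl minkdot_vecLM mulr0.
Qed.

(* [- (l_i + l_j) / 2], with [{i, j, k} = {1, 2, 3}], is the basis of the
   orthogonal of [v_e] dual to the [l_k = v_(k, e_k)]. *)
Lemma minkdot_xML c e k : minkdot (xM c e) (vL k (e k)) = yM c e k.
Proof.
rewrite minkdot_suml !sum3 !minkdotZl !minkdot_vecLL.
by move: k; apply: ord3P; rewrite /=; field.
Qed.

Lemma comm22_ind (P : gen22 -> gen22 -> Prop) :
  (forall e d, (#|[pred k | e k != d k]| <= 1)%N -> P (GenP e) (GenM d)) ->
  (forall e k, P (GenP e) (GenL k (e k))) ->
  (forall e k, P (GenM e) (GenL k (e k))) ->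
  forall s t, comm22 s t -> P s t.
Proof.
move=> PM PL ML [e|e|k b] [d|d|j b'] st; try discriminate st.
- exact: PM.
- by move/eqP: st => <-; exact: PL.
- by move/eqP: st => <-; exact: ML.
Qed.

Lemma param_cocycle c : Z (param c).
Proof.
apply/gen_cocycles_mk; split.
- by case=> [e|e|k b]; [exact: skew0|exact: skew_wedge|exact: skew_wedge].
- have refl_inv x v : minkdot v v = 1 -> minkdot x v = 0 ->
      reflmx v *m wedge x v *m reflmx v + wedge x v = 0.
    move=> vv xv; rewrite reflmx_conj //; last exact: skew_wedge.
    by rewrite wedge_mul vv xv scale1r scale0r subr0 addrAC -mulr2n scaler_nat
      subrr.
  case=> [e|e|k b] /=; first by rewrite mulmx0 mul0mx addr0.
    by apply: refl_inv; [exact: minkdot_vecM|exact: minkdot_xM].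
  by apply: refl_inv; [exact: minkdot_vecL|exact: minkdot_xL].
- case=> [e|e|k b] /=; first by rewrite mul1mx scaleN1r addNr.
    by rewrite scale1r -scalemxAr reflmx_id ?minkdot_vecM // scalerN addNr.
  by rewrite mulmx0 scaler0 addr0.
- apply: comm22_ind => [e d _|e k|e k] /=.
  + by rewrite mul1mx mulmx1 mulmx0 mul0mx addr0 add0r.
  + by rewrite mul1mx mulmx1 mulmx0 mul0mx addr0 add0r.
  + apply/reflmx_conj_comm.
    * exact: minkdot_vecM.
    * exact: minkdot_vecL.
    * exact: minkdot_vecML.
    * exact: minkdot_xM.
    * exact: minkdot_xL.
    * by rewrite minkdot_xML (minkdotC (vM e)) addNr.
- apply: comm22_ind => [e d st|e k|e k] /=.
  + rewrite mul1mx scale1r scaleN1r -scalemxAr reflmxE scalerBr !scalerA.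
    have := sgn3_vecMM R st => <-.
    by apply/colP => i; rewrite !mxE; ring.
  + rewrite mulmx0 scaler0 add0r addr0 scale1r -scalemxAr.
    by rewrite reflmx_perp // minkdot_vecLM.
  + rewrite mulmx0 scaler0 add0r addr0 scale1r -scalemxAr.
    by rewrite reflmx_perp // minkdot_vecLM.
Qed.

(** An infinitesimal boost [u] and, for antisymmetric [W], an infinitesimal rotation. *)
Definition blocks_o13 (u : 'cV[R]_3) (W : 'M[R]_3) : 'M[R]_(1 + 3) :=
  block_mx 0 u^T u W.

Lemma skew_blocks u W : W^T = - W -> skew (blocks_o13 u W).
Proof.
move=> WN; rewrite /skew /blocks_o13 /minkJ tr_block_mx !mulmx_block trmxK WN.
rewrite trmx0 !mulmx0 !mul0mx !addr0 !add0r !mulmx1 !mul1mx opp_block_mx.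
by rewrite mul_scalar_mx mul_mx_scalar !oppr0 !scaleN1r opprK.
Qed.

Lemma skewE a : skew a ->
  a = blocks_o13 (dlsubmx a) (drsubmx a) /\ (drsubmx a)^T = - drsubmx a.
Proof.
rewrite /skew -{1 2}(submxK a) /minkJ tr_block_mx !mulmx_block opp_block_mx.
rewrite !mulmx0 !mul0mx !addr0 !add0r !mulmx1 !mul1mx.
rewrite !mul_scalar_mx !mul_mx_scalar !scaleN1r !opprK.
move=> /eq_block_mx[ul ur dl dr]; split=> //.
rewrite -[LHS]submxK /blocks_o13; congr block_mx.
  apply/matrixP => i j; rewrite !ord1 [RHS]mxE.
  have := congr1 (fun M : 'M[R]_1 => M 0 0) ul.
  by rewrite [LHS]mxE [X in - X]mxE => h; lra.
by rewrite ur.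
Qed.

(** The two signs [b] separate [u j] from [W j k], so six coordinates of displacements, those with
    [k = j + 1], determine an element of o(1,3). *)
Lemma blocks_vecL u W k b j : dsubmx (blocks_o13 u W *m vL k b) j 0 =
  u j 0 + (-1) ^+ b * sqrt2 * W j k.
Proof.
rewrite /blocks_o13 /vecL mul_block_col col_mxKd mulmx1 -scalemxAr mxE;
  congr (_ + _).
by rewrite mxE -colE mxE.
Qed.

Lemma coboundary_gen a w s : Ad (rho0_gen R s) (mk sigma a w) - mk sigma a w =
  mk sigma (rot R s *m a *m rot R s - a) (sgn4 R s *: (rot R s *m w) - w).
Proof. by rewrite Ad_rho0_gen mkB. Qed.

Lemma coboundary_refl a v : skew a -> minkdot v v = 1 ->
  reflmx v *m a *m reflmx v - a = wedge ((-2) *: (a *m v)) v.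
Proof.
by move=> ska vv; rewrite reflmx_conj // addrAC subrr add0r -scaleNr wedgeZl.
Qed.

Lemma ord3_cases (j k : 'I_3) : [\/ k = j, k = j + 1 | j = k + 1].
Proof.
move: j; apply: ord3P; move: k; apply: ord3P;
  by [constructor 1; exact: val_inj|constructor 2;
    exact: val_inj|constructor 3; exact: val_inj].
Qed.

Lemma ord3_neq (j : 'I_3) : (j == j + 1 = false) * (j + 1 == j = false) *
  (j + 2 == j + 1 = false) * (j + 2 == j = false) * (j == j + 1 + 1 = false) *
  (j + 1 == j + 1 + 1 = false) * (j + 1 + 2 = j).
Proof. by move: j; apply: ord3P; do !split; exact: val_inj. Qed.

Lemma param_inj c : B (param c) -> c =1 fun=> 0.
Proof.
move=> [X [a [w [ska ->]]] /(_ _)] cob.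
have {}cob s : param_a c s = rot R s *m a *m rot R s - a /\
    param_w c s = sgn4 R s *: (rot R s *m w) - w.
  by apply: (@mk_inj R sigma); rewrite -coboundary_gen -cob.
have cN : c None = 0.
  (* A coboundary takes the same value [-2 w] on all [p_e], while the first coordinate of
     [sgn3 e v_e] changes sign between adjacent vertices. *)
  have wP e : (c None * sgn3 R e) *: vM e = -2 *: w.
    have [_] := cob (GenP e); rewrite /= mul1mx scaleN1r => ->.
    by rewrite scaleNr scaler_nat mulr2n opprD.
  have := wP (ffun3 true false false); rewrite -(wP (ffun3 false false false)).
  have uZ k (x : 'cV[R]_(1 + 3)) : usubmx (k *: x) 0 0 = k * usubmx x 0 0.
    by rewrite linearZ mxE.
  move=> /(congr1 (fun x : 'cV[R]_(1 + 3) => usubmx x 0 0)).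
  rewrite !uZ !vecM_u /sgn3.
  rewrite !prod3 !ffun3_val => /eqP; rewrite -subr_eq0 => h.
  have : c None * sqrt2 = 0 by move/eqP: h; rewrite /=; lra.
  by move/eqP; rewrite mulf_eq0 (gt_eqF (sqrt2_gt0 R)) orbF => /eqP.
have [aE WN] := skewE ska.
set u := dlsubmx a in aE; set W := drsubmx a in aE WN.
have WC i j : W i j = - W j i.
  by have := congr1 (fun M : 'M[R]_3 => M j i) WN; rewrite !mxE.
have etaE k b j : eta c k b j = -2 * (u j 0 + (-1) ^+ b * sqrt2 * W j k).
  have vv := minkdot_vecL R k b; have va := skew_dotvv (vL k b) ska.
  have [aL _] := cob (GenL k b); move: aL; rewrite /= coboundary_refl //.
  move/(congr1 (fun M => M *m vL k b)); rewrite !wedge_mul vv minkdot_xL.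
  rewrite minkdotZl minkdotC va mulr0 !scale0r !subr0 !scale1r => xE.
  by rewrite -xL_d xE linearZ /= mxE -blocks_vecL -aE.
(* The normalization of [eta] at [k = j + 1], for both signs, kills [u] and, with antisymmetry,
   [W]. *)
have next j : u j 0 = 0 /\ W j (j + 1) = 0.
  have e b : eta c (j + 1) b j = 0 by rewrite /eta eqxx.
  have := e false; have := e true; rewrite !etaE expr1 expr0 => h1 h2.
  split; first by lra.
  have /eqP : sqrt2 * W j (j + 1) = 0 by lra.
  by rewrite mulf_eq0 (gt_eqF (sqrt2_gt0 R)) => /eqP.
have W0 i j : W i j = 0.
  case: (ord3_cases i j) => [->|->|->].
  - by have := WC i i; lra.
  - exact: (next i).2.
  - by rewrite WC (next j).2 oppr0.
have eta0 k b j : eta c k b j = 0 by rewrite etaE W0 (next j).1 mulr0 addr0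
  mulr0.
(* The parameter [(j, t, b)] is the value of [eta] at [k = j] or at [k = j + 2], according to
   [t]. *)
case=> [[[j t] b]|//].
case: t.
  by have := eta0 j b j; rewrite /eta eqxx ord3_neq.
by have := eta0 (j + 2) b j; rewrite /eta !ord3_neq.
Qed.

(** A coboundary and parameters are chosen so that the difference vanishes on the data of
    [gen_cocycle_rigid], which then makes it zero. *)
Lemma param_surj D : Z D -> exists c, B (D - param c).
Proof.
move=> ZD.
have [a [w DE]] : exists (a : gen22 -> 'M[R]_(1 + 3)) (w : gen22 -> 'cV[R]_(1 +
  3)),
    D = fun s => mk sigma (a s) (w s).
  have [gD _ _] := ZD.
  have [p pP] := choice gD.
  have [q qP] := choice pP.
  by exists p, q; apply/funext => s; have [] := qP s.
rewrite DE in ZD *; have [ska ai wi ac wc] := iffLR (gen_cocycles_mk _ _ _) ZD.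
pose z k b := a (GenL k b) *m vL k b.
have zE k b : a (GenL k b) = wedge (z k b) (vL k b).
  exact: reflmx_conj_opp (ska _) (minkdot_vecL R k b) (ai (GenL k b)).
have zv k b : minkdot (z k b) (vL k b) = 0 by rewrite minkdotC skew_dotvv.
pose h k b j := dsubmx (z k b) j 0.
(* Solution of [h (j + 1) b j + 2 (p_j + (-1)^b sqrt 2 q_j) = 0] for both [b], where [q_j] is the
   entry [(j, j + 1)] of [W]. *)
pose p : 'cV[R]_3 := \col_j (- (h (j + 1) false j + h (j + 1) true j) / 4).
pose q (j : 'I_3) : R := - (h (j + 1) false j - h (j + 1) true j) / (4 * sqrt2).
pose W : 'M[R]_3 := \matrix_(i, j)
  (if j == i + 1 then q i else if i == j + 1 then - q j else 0).
have WN : W^T = - W.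
  apply/matrixP => i j; rewrite !mxE; case: (ord3_cases i j) => ->.
  - by rewrite !ord3_neq oppr0.
  - by rewrite !ord3_neq eqxx.
  - by rewrite !ord3_neq eqxx opprK.
pose A := blocks_o13 p W; have skA : skew A by exact: skew_blocks.
(* The coboundary of [A] displaces [vL k b] by [-2 A v]; [z'] is what remains after subtracting
   it. *)
pose z' k b := z k b + 2 *: (A *m vL k b).
have z'v k b : minkdot (z' k b) (vL k b) = 0.
  by rewrite minkdotDl zv minkdotZl minkdotC skew_dotvv // mulr0 addr0.
have z'd k b j : dsubmx (z' k b) j 0 =
    h k b j + 2 * (p j 0 + (-1) ^+ b * sqrt2 * W j k).
  by rewrite linearD linearZ /= [LHS]mxE [X in _ + X]mxE blocks_vecL.
have z'0 b j : dsubmx (z' (j + 1) b) j 0 = 0.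
  have s0 : sqrt2 != 0 by rewrite gt_eqF ?sqrt2_gt0.
  rewrite z'd [p _ _]mxE [W _ _]mxE eqxx /q.
  by case: b; rewrite ?expr1 ?expr0; field.
pose w0 := w (GenP (ffun3 false false false)).
pose l0 := w (GenL 0 true).
pose al := minkdot (vL 0 true) l0.
have l0E : l0 = al *: vL 0 true.
  have := wi (GenL 0 true); rewrite /= scale1r reflmxE -/l0 -/al => h0.
  apply/colP => i; have := congr1 (fun x : 'cV_(1 + 3) => x i 0) h0.
  by rewrite !mxE; lra.
(* [t] and [V] solve two equations: [w0 - t v + 2 V = 0] on [p] at +++, where [v] is its [vM], and
   [al + 2 <vL 0 true, V> = 0] on [l]. They are solvable since [<vL 0 true, v> = - 2 sqrt 2] is
   nonzero. *)
pose t : R := (al - minkdot (vL 0 true) w0) / (2 * sqrt2).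
pose c (i : I) : R :=
  if i is Some (j, d, b) then dsubmx (z' (if d then j else j + 2) b) j 0 else t.
pose V : 'cV[R]_(1 + 3) := 2^-1 *: (t *: vM (ffun3 false false false) - w0).
have xLE k b : xL c k b = z' k b.
  rewrite [RHS](vecL_coord (z'v k b)).
  have eE j : eta c k b j = dsubmx (z' k b) j 0.
    rewrite /eta; case: (ord3_cases j k) => ->.
    - by rewrite eqxx ord3_neq.
    - by rewrite eqxx z'0.
    - by rewrite !ord3_neq /c ord3_neq.
  by rewrite /xL eE; congr col_mx; apply/colP => j; rewrite mxE eE.
exists c; exists (mk sigma A V); first by exists A, V.
have DP : (fun s => mk sigma (a s) (w s)) - param c -
    (fun s => Ad (rho0_gen R s) (mk sigma A V) - mk sigma A V) =
  (fun s => mk sigma (a s - param_a c s - (rot R s *m A *m rot R s - A))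
    (w s - param_w c s - (sgn4 R s *: (rot R s *m V) - V))).
  by apply/funext => s; rewrite !fctE /= coboundary_gen !mkB.
have ZP : Z ((fun s => mk sigma (a s) (w s)) - param c -
    (fun s => Ad (rho0_gen R s) (mk sigma A V) - mk sigma A V)).
  apply: gen_cocyclesB; first by apply: gen_cocyclesB => //;
    exact: param_cocycle.
  by apply: gen_coboundary_cocycle; exists A, V.
move=> s; apply/eqP; rewrite -subr_eq0; apply/eqP.
rewrite DP in ZP; have [|||a0 w1] := gen_cocycle_rigid ZP _ _ _ s.
- move=> k b; rewrite /= xLE zE coboundary_refl ?minkdot_vecL // /z' wedgeDl
  !wedgeZl.
  by rewrite opprD addrA subrr add0r scaleNr opprK addNr.
- rewrite /= mul1mx -/w0 /sgn3 prod3 !ffun3_val expr0 !mulr1 /V.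
  by apply/colP => i; rewrite !mxE /t; lra.
- rewrite /= -/l0 subr0 scale1r reflmxE !opprB (addrCA V) subrr addr0 l0E
  -scalerDl.
  have vLM : minkdot (vL 0 true) (vM (ffun3 false false false)) = - (2 * sqrt2).
    by rewrite minkdotC minkdot_vecLr vecM_u vecM_d ffun3_val expr0 expr1; ring.
  rewrite /V minkdotZr minkdotDr minkdotNr minkdotZr vLM.
  rewrite (_ : _ + _ = 0) ?scale0r // /t.
  by field; rewrite gt_eqF ?sqrt2_gt0.
have := congr1 (fun F : gen22 -> 'M[R]_5 => F s) DP.
by rewrite /= a0 w1 mk0 !fctE.
Qed.

Lemma quotient_dim_gen : quotient_dim Z B 13%N.
Proof.
have -> : 13%N = #|{: I}| by rewrite card_option !card_prod card_ord card_bool.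
apply: (@quotient_dim_param _ _ _ Z B param).
- exact: param_lin.
- move=> v w [X gX vE] [Y gY wE]; exists (X - Y).
    by rewrite -scaleN1r; apply: g_blockD => //; exact: g_blockZ.
  by move=> s; rewrite !fctE vE wE AdB !opprD addrACA.
- exact: param_cocycle.
- exact: param_surj.
- exact: param_inj.
Qed.

End Parametrization.

(** * The Lie algebras *)

Section LieAlgebras.
Variable R : realType.
Implicit Types (s t : R) (x y z : 'cV[R]_5) (A X : 'M[R]_5).

Definition form_coef s (i : 'I_5) : R :=
  if i == 0 then -1 else if i == 4 then s else 1.

Definition bform s x y : R := \sum_i form_coef s i * (x i 0 * y i 0).

Lemma sum5 (F : 'I_5 -> R) : \sum_i F i = F 0 + F 1 + F 2 + F 3 + F 4.
Proof.
rewrite !big_ord_recl big_ord0 addr0 !addrA.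
by congr (_ + F _ + F _ + F _ + F _); exact: val_inj.
Qed.

Lemma qformE s x : qform s x = bform s x x.
Proof. by rewrite /qform /bform sum5 /form_coef /=; ring. Qed.

Lemma bformC s x y : bform s x y = bform s y x.
Proof. by apply: eq_bigr => i _; rewrite (mulrC (x i 0)). Qed.

Lemma bformDr s x y z : bform s x (y + z) = bform s x y + bform s x z.
Proof. by rewrite -big_split; apply: eq_bigr => i _ /=; rewrite mxE; ring. Qed.

Lemma bformZr s k x y : bform s x (k *: y) = k * bform s x y.
Proof. by rewrite mulr_sumr; apply: eq_bigr => i _; rewrite mxE; ring. Qed.

Lemma bformNr s x y : bform s x (- y) = - bform s x y.
Proof. by rewrite -scaleN1r bformZr mulN1r. Qed.

Lemma qformD s x y : qform s (x + y) = qform s x + 2 * bform s x y + qform s y.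
Proof.
by rewrite !qformE bformDr !(bformC s (x + y)) !bformDr (bformC s y x); lra.
Qed.

Lemma qformZ s k x : qform s (k *: x) = k ^+ 2 * qform s x.
Proof. by rewrite !qformE bformZr bformC bformZr expr2 mulrA. Qed.

Lemma qformN s x : qform s (- x) = qform s x.
Proof. by rewrite !qformE bformNr bformC bformNr opprK. Qed.

Lemma orthogonal_bform s A x y : orthogonal_group s A ->
  bform s (A *m x) (A *m y) = bform s x y.
Proof.
move=> [_ qA]; have := qA (x + y); rewrite mulmxDr !qformD !qA => h; lra.
Qed.

Lemma bform_delta s (i : 'I_5) x :
  bform s (delta_mx i 0) x = form_coef s i * x i 0.
Proof.
rewrite /bform (bigD1 i) //= big1 ?addr0 => [|k ki].
  by rewrite mxE !eqxx mul1r.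
by rewrite mxE (negPf ki) mul0r mulr0.
Qed.

Lemma mul_deltaE A i j : (A *m (delta_mx j 0 : 'cV[R]_5)) i 0 = A i j.
Proof. by rewrite -colE mxE. Qed.

Lemma orthogonal_entries s A i j : orthogonal_group s A ->
  \sum_k form_coef s k * (A k i * A k j) = form_coef s i * (i == j)%:R.
Proof.
move=> OA; have := orthogonal_bform (delta_mx i 0) (delta_mx j 0) OA.
rewrite bform_delta // mxE eqxx andbT => <-.
by apply: eq_bigr => k _; rewrite !mul_deltaE.
Qed.

(* The form is nonnegative on [y_0 x - x_0 y], whose coordinate of index 0
   vanishes. *)
Lemma upper_sheet_bform_lt0 s x y : 0 <= s ->
  upper_sheet s x -> upper_sheet s y -> bform s x y < 0.
Proof.
move=> s0 [qx x0] [qy y0].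
set a := x 0 0 in x0; set b := y 0 0 in y0.
have : 0 <= qform s (b *: x + (- a) *: y).
  rewrite /qform !mxE -/a -/b (_ : b * a + - a * b = 0); last by ring.
  by rewrite expr0n /= oppr0 add0r !addr_ge0 ?sqr_ge0 // mulr_ge0 ?sqr_ge0.
rewrite qformD !qformZ bformZr bformC bformZr bformC qx qy => h.
have ab : 0 < a * b by rewrite mulr_gt0.
have : 0 < a * b * (- bform s x y).
  have := mulr_gt0 x0 x0; have := mulr_gt0 y0 y0; lra.
by rewrite pmulr_rgt0 // oppr_gt0.
Qed.

(** As [A 0 0 > 0], the point [A e_0] is on the upper sheet, and its product with [A x] is
    [- x_0 < 0]. Were [A x] on the lower sheet, its product with [A e_0] would be positive; and
    [q >= 0] where the first coordinate is 0. *)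
Lemma upper_sheet_image s A x : 0 <= s -> orthogonal_group s A ->
  0 < A 0 0 -> upper_sheet s x -> upper_sheet s (A *m x).
Proof.
move=> s0 OA A00 xU; have [_ qA] := OA; have [qx x0] := xU.
have qAx : qform s (A *m x) = -1 by rewrite qA.
split=> //; pose u := A *m (delta_mx 0 0 : 'cV[R]_5).
have uU : upper_sheet s u.
  split; last by rewrite /u mul_deltaE.
  by rewrite qA qformE bform_delta [X in _ * X]mxE !eqxx mulr1.
have b0 : bform s u (A *m x) < 0.
  by rewrite orthogonal_bform // bform_delta /form_coef /= mulN1r oppr_lt0.
rewrite ltNge; apply/negP; rewrite le_eqVlt => /orP[/eqP Ax0|Ax0].
  move: qAx; rewrite /qform Ax0 expr0n oppr0 add0r.
  have : 0 <= (A *m x) 1 0 ^+ 2 + (A *m x) 2 0 ^+ 2 + (A *m x) 3 0 ^+ 2 + s *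
    (A *m x) 4 0 ^+ 2.
    by rewrite !addr_ge0 ?sqr_ge0 // mulr_ge0 ?sqr_ge0.
  by move=> h1 h2; lra.
have NU : upper_sheet s (- (A *m x)) by split; rewrite ?qformN // mxE oppr_gt0.
by have := upper_sheet_bform_lt0 s0 uU NU; rewrite bformNr; lra.
Qed.

Lemma orthogonal_group_inv s A : orthogonal_group s A -> orthogonal_group s
  (invmx A).
Proof.
move=> [uA qA]; split; first by rewrite unitmx_inv.
by move=> x; rewrite -qA mulmxA mulmxV // mul1mx.
Qed.

Lemma preserves_upper_sheet s A : 0 <= s -> orthogonal_group s A ->
  0 < A 0 0 -> preserves A (upper_sheet s).
Proof.
move=> s0 OA A00; have [uA _] := OA; apply/seteqP; split=> [_ [x xU <-]|x xU].
  exact: upper_sheet_image.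
have [_ qV] := orthogonal_group_inv OA.
exists (invmx A *m x); last by rewrite mulmxA mulmxV // mul1mx.
have Vx0 : (invmx A *m x) 0 0 != 0.
  apply/eqP => V0; have [qx _] := xU; have := qV x.
  rewrite qx /qform V0 expr0n oppr0 add0r.
  set y := _ *m x; have : 0 <= y 1 0 ^+ 2 + y 2 0 ^+ 2 + y 3 0 ^+ 2 + s * y 4 0
    ^+ 2.
    by rewrite !addr_ge0 ?sqr_ge0 // mulr_ge0 ?sqr_ge0.
  by move=> h1 h2; lra.
have [qx x0] := xU; split; first by rewrite qV.
(* If the preimage of [x] were on the lower sheet, [A] would send its opposite to [- x], which is
   not on the upper sheet. *)
rewrite lt_neqAle eq_sym Vx0 /= leNgt; apply/negP => V0.
have NU : upper_sheet s (- (invmx A *m x)).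
  by split; rewrite ?qformN ?qV // mxE oppr_gt0.
have [_] := upper_sheet_image s0 OA A00 NU.
by rewrite mulmxN mulmxA mulmxV // mul1mx mxE; lra.
Qed.

Definition form_skew s X : Prop :=
  forall i j, form_coef s j * X j i + form_coef s i * X i j = 0.

Lemma form_skew_bform s X z : form_skew s X -> bform s z (X *m z) = 0.
Proof.
move=> skX; pose S i j := form_coef s i * X i j * (z i 0 * z j 0).
have bE : bform s z (X *m z) = \sum_i \sum_j S i j.
  apply: eq_bigr => i _; rewrite mxE mulr_sumr mulr_sumr; apply: eq_bigr => j _.
  by rewrite /S; ring.
have : bform s z (X *m z) = - bform s z (X *m z).
  rewrite bE [LHS]exchange_big /= -sumrN; apply: eq_bigr => i _.
  rewrite -sumrN; apply: eq_bigr => j _; rewrite /S.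
  have -> : form_coef s j * X j i = - (form_coef s i * X i j).
    by apply/eqP; rewrite -subr_eq0 opprK skX.
  by ring.
by move=> h; lra.
Qed.

(** With [x = (1 - Y) z] one has [A x = (1 + Y) z], and the values of [q] at these differ by
    [4 b(z, Y z) = 0]. *)
Lemma cayley_orthogonal s t A X : form_skew s X -> A \in unitmx ->
  1 - t *: (2^-1 *: X) \in unitmx ->
  A *m (1 - t *: (2^-1 *: X)) = 1 + t *: (2^-1 *: X) -> orthogonal_group s A.
Proof.
move=> skX uA uY AY; split=> // x.
set Y := t *: _ in uY AY.
have -> : x = (1 - Y) *m (invmx (1 - Y) *m x) by rewrite mulmxA mulmxV //
  mul1mx.
move: (_ *m x) => z; rewrite mulmxA AY mulmxDl mulmxBl !mul1mx.
rewrite !qformD qformN bformNr.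
by rewrite /Y -!scalemxAl !bformZr form_skew_bform // !mulr0 oppr0 mulr0.
Qed.

Lemma is_derive_entry (c : R -> 'M[R]_5) X k l : is_derive (0 : R) 1 c X ->
  is_derive (0 : R) 1 (fun t => c t k l) (X k l).
Proof.
move=> [dc cE]; apply: DeriveDef; first exact: (derivable_mxP c 0 1).1 dc k l.
by have := derive_mx dc; rewrite cE => /matrixP/(_ k l); rewrite mxE => ->.
Qed.

(** The relations [orthogonal_entries] hold along the curve near 0; their derivative at 0, where [c]
    is 1, is form-skewness. *)
Lemma sub_lie_algebra_bform s X (G : set 'M[R]_5) :
  G `<=` orthogonal_group s -> lie_algebra G X -> form_skew s X.
Proof.
move=> GO [c [c0 cG cX]] i j.
have cXE k l : is_derive (0 : R) 1 (fun t => c t k l) (X k l).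
  exact: is_derive_entry.
pose f k (t : R) := form_coef s k * (c t k i * c t k j).
have df k : is_derive (0 : R) 1 (f k)
    (form_coef s k * (c 0 k i * X k j + c 0 k j * X k i)).
  exact: (is_deriveZ (form_coef s k) (is_deriveM (cXE k i) (cXE k j))).
have dsum := is_derive_sum df.
have d0 : is_derive (0 : R) 1 (\sum_k f k) 0.
  apply: (@near_eq_is_derive _ _ _ (cst (form_coef s i * (i == j)%:R))).
  near=> t; rewrite fct_sumE orthogonal_entries //; apply: GO.
  by have [] : G (c t) /\ derivable c t 1 by near: t.
have [_ e1] := dsum; have [_ e0] := d0; move: e0; rewrite e1 c0.
have delta (F : 'I_5 -> R) k : \sum_l F l * (1 : 'M[R]_5) l k = F k.
  rewrite (bigD1 k) //= big1 => [|l lk]; first by rewrite mxE eqxx mulr1 addr0.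
  by rewrite mxE (negPf lk) mulr0.
rewrite (eq_bigr (fun k => form_coef s k * X k j * (1 : 'M[R]_5) k i +
  form_coef s k * X k i * (1 : 'M[R]_5) k j)) => [|k _]; last by ring.
by rewrite big_split /= !delta addrC.
Unshelve. all: by end_near. Qed.

Lemma diag_form_coef s : diag_mx (\row_(i < 1 + 3 + 1) form_coef s i) =
  block_mx (minkJ R) 0 0 (s%:M : 'M[R]_1) :> 'M[R]_(1 + 3 + 1).
Proof.
have -> : \row_(i < 1 + 3 + 1) form_coef s i =
    row_mx (row_mx (const_mx (-1)) (const_mx 1)) (const_mx s) :> 'rV[R]_(1 + 3
      + 1).
  apply/rowP => i; rewrite mxE; case: (split_ordP i) => {}i ->.
    rewrite row_mxEl; case: (split_ordP i) => {}i ->.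
      by rewrite row_mxEl mxE /form_coef (ord1 i).
    rewrite row_mxEr mxE /form_coef; move: i; exact: ord3P.
  by rewrite row_mxEr mxE /form_coef (ord1 i).
by rewrite !diag_mx_row !diag_const_mx.
Qed.

Lemma form_skew_mx s (X : 'M[R]_(1 + 3 + 1)) : form_skew s X <->
  X^T *m diag_mx (\row_(i < 1 + 3 + 1) form_coef s i) = - (diag_mx (\row_(i < 1
    + 3 + 1) form_coef s i) *m X).
Proof.
rewrite mul_mx_diag mul_diag_mx; split=> [skX|/matrixP skX i j].
  by apply/matrixP => i j; rewrite !mxE; have := skX i j; lra.
by have := skX i j; rewrite !mxE; lra.
Qed.

(** When [s = 0], form-skewness leaves the entry [X 4 4] free, whence the second condition. *)
Lemma g_blockP s X : g_block s X <-> form_skew s X /\ X 4 4 = 0.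
Proof.
have X44 : X 4 4 = (@drsubmx _ 4 1 4 1 X) 0 0.
  by rewrite !mxE; congr (X _ _); exact: val_inj.
rewrite form_skew_mx diag_form_coef X44.
have blk (Y : 'M[R]_(1 + 3 + 1)) :
    Y^T *m block_mx (minkJ R) 0 0 (s%:M : 'M[R]_1) =
      - (block_mx (minkJ R) 0 0 (s%:M : 'M[R]_1) *m Y) <->
    [/\ skew (ulsubmx Y), s *: (dlsubmx Y)^T = - (minkJ R *m ursubmx Y) &
      s *: drsubmx Y = 0].
  rewrite -{1 2}(submxK Y) tr_block_mx !mulmx_block opp_block_mx.
  rewrite !mulmx0 !mul0mx !addr0 !add0r !mul_mx_scalar !mul_scalar_mx /skew.
  have drT : (drsubmx Y)^T = drsubmx Y by rewrite [drsubmx Y]mx11_scalar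
    tr_scalar_mx.
  rewrite drT; split=> [/eq_block_mx[-> -> _ dr]|[-> dl dr]]; [split=> //|].
    apply/matrixP => i j; have := congr1 (fun M : 'M[R]_1 => M i j) dr.
    by rewrite !mxE => h; lra.
  rewrite dl dr oppr0; congr block_mx; apply/eqP; rewrite -eqr_oppLR; apply/eqP.
  by apply: trmx_inj; rewrite linearN linearZ /= dl trmx_mul trmxK minkJ_tr.
split=> [[a [w [ska ->]]]|[/blk[ska urE drE] X44']].
  split.
    apply/(blk (block_mx a (s *: w) (- mdual w) 0)).
    rewrite block_mxKul block_mxKdl block_mxKur block_mxKdr scaler0; split=> //.
    by rewrite mdualE linearN /= trmx_mul trmxK minkJ_tr -scalemxAr scalerN.
  by rewrite [drsubmx _](@block_mxKdr _ 4 1 4 1) mxE.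
(* [w] is read off the lower row, as the upper right block is zero when [s = 0]. *)
pose w : 'cV[R]_(1 + 3) := - (minkJ R *m (@dlsubmx _ 4 1 4 1 X)^T).
exists (@ulsubmx _ 4 1 4 1 X), w; split=> //.
rewrite /mk (_ : s *: w = @ursubmx _ 4 1 4 1 X); last first.
  by rewrite /w scalerN scalemxAr urE mulmxN opprK mulmxA minkJJ mul1mx.
rewrite (_ : - mdual w = @dlsubmx _ 4 1 4 1 X); last first.
  by rewrite mdualE /w linearN /= trmx_mul trmxK minkJ_tr mulNmx opprK -mulmxA
    minkJJ mulmx1.
rewrite (_ : 0 = @drsubmx _ 4 1 4 1 X);
  first exact: (esym (@submxK _ 4 1 4 1 X)).
by apply/matrixP => i j; rewrite !ord1 X44' mxE.
Qed.

Lemma lie_algebra_orthogonal s X : s != 0 -> lie_algebra (orthogonal_group s) X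
  ->
  g_block s X.
Proof.
move=> s0 LX; have skX := sub_lie_algebra_bform (fun A OA => OA) LX.
apply/g_blockP; split=> //; have /eqP := skX 4 4.
by rewrite -mulr2n mulrn_eq0 mulf_eq0 /= (negPf s0) => /eqP.
Qed.

Lemma lie_algebraS (G G' : set 'M[R]_5) : G `<=` G' ->
  lie_algebra G `<=` lie_algebra G'.
Proof.
move=> GG' X [c [c0 cG cX]]; exists c; split=> //.
by near=> t; have [/GG'] : G (c t) /\ derivable c t 1 by near: t.
Unshelve. all: by end_near. Qed.

(** The Cayley curve of [X] stays in [G] near 0. For [s = 0] column 4 of [X] vanishes, so the curve
    fixes [e_4]. *)
Lemma g_block_lie_algebra s X (G : set 'M[R]_5) :
  (forall A, orthogonal_group s A -> 0 < A 0 0 ->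
     (s = 0 -> A *m (delta_mx 4 0 : 'cV[R]_5) = delta_mx 4 0) -> G A) ->
  g_block s X -> lie_algebra G X.
Proof.
move=> GO /g_blockP[skX X44]; have [c [c0 cX cn]] := cayley_curve X.
exists c; split=> //; near=> t.
have [dc uc c00 uY cY] : [/\ derivable c t 1, c t \in unitmx, 0 < c t 0 0,
    1 - t *: (2^-1 *: X) \in unitmx &
    c t *m (1 - t *: (2^-1 *: X)) = 1 + t *: (2^-1 *: X)] by near: t.
split=> //; apply: GO => //; first exact: cayley_orthogonal cY.
move=> s0; have X4 : X *m (delta_mx 4 0 : 'cV[R]_5) = 0.
  apply/colP => i; rewrite mul_deltaE [RHS]mxE.
  case: (eqVneq i 4) => [->//|i4]; have /eqP := skX i 4.
  rewrite /form_coef /= s0 (negPf i4) mul0r add0r mulf_eq0.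
  by case: (i == 0); rewrite ?oppr_eq0 oner_eq0 => /eqP.
have := congr1 (fun M : 'M[R]_5 => M *m (delta_mx 4 0 : 'cV[R]_5)) cY.
rewrite -mulmxA mulmxBl mulmxDl mul1mx -!scalemxAl X4 !scaler0.
by rewrite subr0 addr0.
Unshelve. all: by end_near. Qed.

Lemma lie_algebraE (G : set 'M[R]_5) :
  [\/ G = @IsomH4 R, G = @IsomAdS4 R | G = @G_HP4 R] ->
  exists s, lie_algebra G = g_block s.
Proof.
case=> ->.
- exists 1; apply/seteqP; split=> X.
    move/(lie_algebraS (fun A (AG : IsomH4 A) => AG.1)).
    by apply: lie_algebra_orthogonal; rewrite oner_neq0.
  apply: g_block_lie_algebra => A OA A00 _; split=> //.
  exact: preserves_upper_sheet.
- exists (-1); apply/seteqP; split=> X.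
    by apply: lie_algebra_orthogonal; rewrite oppr_eq0 oner_neq0.
  exact: g_block_lie_algebra.
- exists 0; apply/seteqP; split=> X; last first.
    apply: g_block_lie_algebra => A OA A00 A4; split=> //.
      exact: preserves_upper_sheet.
    by left; exact: A4.
  move=> LX; apply/g_blockP; split.
    by apply: sub_lie_algebra_bform LX => A [].
  have [c [c0 cG cX]] := LX.
  have c44 : is_derive (0 : R) 1 (fun t => c t 4 4) (X 4 4).
    exact: is_derive_entry.
  (* The entry [c t 4 4] is 1 or -1, so its square is constant near 0; the derivative [2 X 4 4] of
     the square is then 0. *)
  have d0 : is_derive (0 : R) 1 ((fun t => c t 4 4) * (fun t => c t 4 4)) 0.
    apply: (@near_eq_is_derive _ _ _ (cst (1 : R))).
    near=> t; have [[_ _ e4] _] : G_HP4 (c t) /\ derivable c t 1 by near: t.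
    have ct : c t 4 4 = 1 \/ c t 4 4 = -1.
      by rewrite -mul_deltaE; case: e4 => ->; rewrite ?mxE eqxx; [left|right].
    by case: ct => ct; rewrite -[RHS]/(c t 4 4 * c t 4 4) ct ?mulrNN mulr1.
  have [_ e1] := is_deriveM c44 c44; have [_ e0] := d0; move: e0.
  by rewrite e1 c0 mxE eqxx scale1r -mulr2n => /eqP; rewrite mulrn_eq0 => /eqP.
Unshelve. all: by end_near. Qed.

End LieAlgebras.

Theorem corollary7p3 (R : realType) (G : set 'M[R]_5) :
  [\/ G = @IsomH4 R, G = @IsomAdS4 R | G = @G_HP4 R] ->
  H1_dim (@rho0 R) (lie_algebra G) 13.
Proof.
move=> /lie_algebraE[s ->]; apply: gen_H1_dim.
- exact: rho0_gen_invol.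
- exact: rho0_gen_comm.
- exact: g_block0.
- exact: g_blockD.
- exact: g_blockZ.
- exact: g_block_Ad.
- exact: quotient_dim_gen.
Qed.
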